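(* Let $(X,T)$ be a Polish dynamical system with the strong approximate product structure. Then: (1) If $|\mathcal{M}_T(X)|\ge 2$, then for any $\mu\in\mathcal{M}_T(X)$ the set $G_\mu$ of $\mu$-generic points is $\boldsymbol{\Pi}^0_3$-complete. (2) For every nonempty closed connected set $V\subseteq\mathcal{M}_T(X)$ with nonempty complement $U=\mathcal{M}_T(X)\setminus V$, the sets $G_V$ and $G(V)$ are $\boldsymbol{\Pi}^0_3$-hard (and so the set ${}^{U}G$ is $\boldsymbol{\Sigma}^0_3$-hard). Also, the set $G^V$ is $\boldsymbol{\Pi}^0_2$-complete. The sets $G_V$, $G^V$, $G(V)$ and ${}^{U}G$ are all dense in $X$.
   Context: A Polish dynamical system $(X,T)$ is a Polish space $X$ with a fixed compatible complete metric $\rho$ and a continuous map $T\colon X\to X$. $X$ is not assumed compact. $\mathcal{M}(X)$ is the space of Borel probability measures on $X$ with the weak$^*$ topology ($\mu_n\to\mu$ iff $\int f\,d\mu_n\to\int f\,d\mu$ for all bounded continuous $f\colon X\to\mathbb{R}$); $\mathcal{M}_T(X)\subseteq\mathcal{M}(X)$ is the subspace of $T$-invariant measures; ''closed'' and ''connected'' refer to this topology. For $x\in X$, $n\ge1$, $\mathcal{E}(x,n)=\frac1n\sum_{j=0}^{n-1}\delta_{T^j(x)}$. $V(x)$ is the set of limit points (limits of convergent subsequences) in $\mathcal{M}(X)$ of the sequence $(\mathcal{E}(x,n))_n$. $G_\mu=\{x\in X:\mathcal{E}(x,n)\to\mu\}$. For $V\subseteq\mathcal{M}_T(X)$: $G^V=\{x: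 V\subseteq V(x)\}$, $G_V=\{x: V(x)\subseteq V\}$, $G(V)=G^V\cap G_V=\{x:V(x)=V\}$, ${}^{V}G=\{x:V(x)\cap V\ne\emptyset\}$. Strong approximate product structure: a specification is a finite sequence $\xi=(\langle x_j,n_j\rangle)_{j=1}^k$ with $x_j\in X$, $n_j\ge1$, $k\ge 1$. For finite $\Lambda\subseteq\{0,1,2,\dots\}$, $B_\Lambda(x,\varepsilon)=\{y:\rho(T^j x,T^j y)<\varepsilon\ \forall j\in\Lambda\}$, and $B_n=B_{\{0,\dots,n-1\}}$. A point $y$ $(\varepsilon,\delta_1,\delta_2)$-approximately-traces $\xi$ if $y\in B_{n_1}(x_1,\varepsilon)$ and for each $2\le j\le k$ there are $\Lambda_j\subseteq\{0,\dots,n_j-1\}$ with $|\Lambda_j|\ge(1-\delta_1)n_j$ and an integer $0\le s_{j-1}\le\delta_2 n_j$ such that $T^{\sum_{i=1}^{j-1}(s_i+n_i)}(y)\in B_{\Lambda_j}(x_j,\varepsilon)$. $(X,T)$ has the strong approximate product structure if for all $\varepsilon,\delta_1,\delta_2>0$ there is a nonnegative integer $N$ such that for every specification with all $n_j\ge N$ there is a point $y\in X$ that $(\varepsilon,\delta_1,\delta_2)$-approximately-traces it. Borel hierarchy: $\boldsymbol{\Sigma}^0_1$ = open sets, $\boldsymbol{\Pi}^0_n$ = complements of $\boldsymbol{\Sigma}^0_n$ sets, $\boldsymbol{\Sigma}^0_{n+1}$ = countable unions of $\boldsymbol{\Pi}^0_n$ sets. $A\subseteq X$ is $\boldsymbol{\Pi}^0_n$-hard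 if $A\notin\boldsymbol{\Sigma}^0_n$, $\boldsymbol{\Sigma}^0_n$-hard if $A\notin\boldsymbol{\Pi}^0_n$; $A$ is $\boldsymbol{\Pi}^0_n$-complete if $A\in\boldsymbol{\Pi}^0_n\setminus\boldsymbol{\Sigma}^0_n$. *)

(* Defs.v *)
From HB Require Import structures.
From mathcomp Require Import all_boot all_order all_algebra.
From mathcomp Require Import all_classical all_reals all_analysis.

Set Implicit Arguments.
Unset Strict Implicit.
Unset Printing Implicit Defensive.

Import Order.TTheory GRing.Theory Num.Theory.
Import numFieldNormedType.Exports.

Local Open Scope classical_set_scope.
Local Open Scope ring_scope.

(* The library's [Complete] and [measurableType] are pointed, so the carrier is
   nonempty; an empty space carries no probability measure. *)
#[short(type="completeMetricType")]
HB.structure Definition CompleteMetric (R : numDomainType) :=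
  {X of Complete X & Metric R X}.

Definition separable (X : topologicalType) : Prop :=
  exists D : set X, countable D /\ dense D.

Section borel_hierarchy.
Context {X : topologicalType}.

(* Indexed from 1, as in the literature; the value at 0 is junk. *)
Fixpoint Sigma0 (n : nat) : set (set X) :=
  match n with
  | 0 => set0
  | 1 => open
  | m.+1 => [set A | exists F : nat -> set X,
               (forall i, Sigma0 m (~` F i)) /\ A = \bigcup_i F i]
  end.

Definition Pi0 (n : nat) : set (set X) := [set A | Sigma0 n (~` A)].

Definition Pi0_hard (n : nat) (A : set X) : Prop := ~ Sigma0 n A.

Definition Sigma0_hard (n : nat) (A : set X) : Prop := ~ Pi0 n A.

Definition Pi0_complete (n : nat) (A : set X) : Prop :=
  Pi0 n A /\ ~ Sigma0 n A.

End borel_hierarchy.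

Notation borelType X := (g_sigma_algebraType (@open X)).

(* An element of [probability T R] is a function on all subsets of T, with
   arbitrary values on the non-measurable ones. Prescribing the value 0 there
   makes Leibniz equality coincide with equality of Borel measures. *)
Record borel_prob (R : realType) (X : ptopologicalType) := BorelProb {
  borel_prob_measure :> probability (borelType X) R ;
  borel_prob_junk : forall A : set (borelType X),
    ~ measurable A -> borel_prob_measure A = 0%E }.

HB.instance Definition _ (R : realType) (X : ptopologicalType) :=
  gen_eqMixin (borel_prob R X).
HB.instance Definition _ (R : realType) (X : ptopologicalType) :=
  gen_choiceMixin (borel_prob R X).

Lemma borel_prob_eqP (R : realType) (X : ptopologicalType)
    (mu nu : borel_prob R X) :
  mu = nu <-> forall A : set (borelType X), measurable A -> mu A = nu A.
Proof.
split=> [->//|munu].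
have {munu} : (mu : set (borelType X) -> \bar R) = nu.
  apply/funext => A; have [mA|mA] := pselect (measurable A); first exact: munu.
  by rewrite !borel_prob_junk.
case: mu nu => [[mu cmu] jmu] [[nu cnu] jnu] /= munu; subst nu.
have E : cmu = cnu.
  case: cmu {jmu jnu} => -[a1 a2] [a3] [a4] [a5] [a6] [a7] [a8].
  case: cnu => -[b1 b2] [b3] [b4] [b5] [b6] [b7] [b8].
  rewrite (Prop_irrelevance b1 a1) (Prop_irrelevance b4 a4).
  rewrite (Prop_irrelevance b5 a5) (Prop_irrelevance b6 a6).
  rewrite (Prop_irrelevance b7 a7) (Prop_irrelevance b8 a8).
  have E : b2 = a2 by exact: Prop_irrelevance.
  by subst b2; rewrite (Prop_irrelevance b3 a3).
by subst cnu; congr BorelProb; exact: Prop_irrelevance.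
Qed.

Section borel_restrict.
Context {R : realType} {X : ptopologicalType}.
Variable P : probability (borelType X) R.
Local Open Scope ereal_scope.

Definition borel_restrict_fun (A : set (borelType X)) : \bar R :=
  if `[< measurable A >] then P A else 0.

Let restrictE A : measurable A -> borel_restrict_fun A = P A.
Proof. by move=> mA; rewrite /borel_restrict_fun asboolT. Qed.

Let restrict0 : borel_restrict_fun set0 = 0.
Proof. by rewrite restrictE ?measure0. Qed.

Let restrict_ge0 A : 0 <= borel_restrict_fun A.
Proof. by rewrite /borel_restrict_fun; case: ifP. Qed.

Let restrict_sigma_additive : semi_sigma_additive borel_restrict_fun.
Proof.
move=> F mF tF mUF; rewrite restrictE//.
under eq_fun do under eq_bigr do rewrite restrictE//.
exact: measure_semi_sigma_additive.
Qed.

HB.instance Definition _ := isMeasure.Build _ _ _ borel_restrict_fun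
  restrict0 restrict_ge0 restrict_sigma_additive.

Let restrictT : borel_restrict_fun setT = 1.
Proof. by rewrite restrictE// probability_setT. Qed.

HB.instance Definition _ := Measure_isProbability.Build _ _ _
  borel_restrict_fun restrictT.

Lemma borel_restrict_junk (A : set (borelType X)) :
  ~ measurable A -> borel_restrict_fun A = 0.
Proof. by move=> mA; rewrite /borel_restrict_fun asboolF. Qed.

Definition borel_restrict : borel_prob R X :=
  @BorelProb R X borel_restrict_fun borel_restrict_junk.

End borel_restrict.

Section weak_star_topology.
Context {R : realType} {X : ptopologicalType}.

Definition bounded_continuous : set (X -> R) :=
  [set f | continuous f /\ [bounded f x | x in [set: X]]].

Definition weak_star_eval (mu : borel_prob R X) :
    {ptws bounded_continuous -> R} :=
  fun f => \int[mu]_x (set_val f x : R).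

End weak_star_topology.

(* The weak* topology: the coarsest one making every mu |-> \int f dmu, with f
   bounded and continuous, continuous. *)
HB.instance Definition _ (R : realType) (X : ptopologicalType) :=
  Topological.copy (borel_prob R X) (initial_topology (@weak_star_eval R X)).

Section empirical_measure.
Context {R : realType} {X : ptopologicalType}.
Variables (T : X -> X) (x : X) (n : nat).
Local Open Scope ereal_scope.

Definition empirical_fun : set (borelType X) -> \bar R :=
  mscale ((n.+1%:R^-1 : R)%:nng)%R
    (msum (fun j => \d_(iter j T x : borelType X)) n.+1).

HB.instance Definition _ := Measure.on empirical_fun.

Let empiricalT : empirical_fun setT = 1.
Proof.
rewrite /empirical_fun /mscale/= /msum (eq_bigr (fun=> 1%R%:E)) => [|j _].
  by rewrite sumEFin sumr_const card_ord -EFinM mulVf// pnatr_eq0.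
exact: diracT.
Qed.

HB.instance Definition _ :=
  Measure_isProbability.Build _ _ _ empirical_fun empiricalT.

(* E(x, n + 1): the average of the Dirac measures at T^j x, 0 <= j <= n. *)
Definition empirical : borel_prob R X := borel_restrict empirical_fun.

End empirical_measure.

Section generic_points.
Context {R : realType} {X : ptopologicalType}.
Variable T : X -> X.
Implicit Types (mu : borel_prob R X) (V : set (borel_prob R X)).

Definition invariant_probs : set (borel_prob R X) :=
  [set mu : borel_prob R X |
    forall A : set (borelType X), measurable A -> mu (T @^-1` A) = mu A].

Definition limit_measures (x : X) : set (borel_prob R X) :=
  [set mu : borel_prob R X | exists phi : nat -> nat,
    {homo phi : m n / (m < n)%N} /\
    empirical T x (phi n) @[n --> \oo] --> mu].

(* G_mu *)
Definition generic mu : set X :=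
  [set x | empirical T x n @[n --> \oo] --> mu].

(* G^V *)
Definition G_upper V : set X := [set x | V `<=` limit_measures x].

(* G_V *)
Definition G_lower V : set X := [set x | limit_measures x `<=` V].

(* G(V) *)
Definition G_exact V : set X := G_upper V `&` G_lower V.

(* ^V G *)
Definition G_meet V : set X := [set x | limit_measures x `&` V !=set0].

End generic_points.

Section approximate_product_structure.
Context {R : realType} {X : metricType R}.
Variable T : X -> X.

Definition bowen_ball (n : nat) (L : {set 'I_n}) (x : X) (e : R) : set X :=
  [set y | forall i, i \in L -> mdist (iter i T x) (iter i T y) < e].

(* A specification with k + 1 terms is indexed from 0: its terms are (x j, n j)
   for j : 'I_k.+1, and s j is the gap between the terms j and j + 1. *)
Definition approx_traces (e d1 d2 : R) (k : nat)
    (x : 'I_k.+1 -> X) (n : 'I_k.+1 -> nat) (y : X) : Prop :=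
  bowen_ball [set: 'I_(n ord0)]%SET (x ord0) e y /\
  exists s : nat -> nat, forall j : 'I_k.+1, (0 < j)%N ->
    (s j.-1)%:R <= d2 * (n j)%:R /\
    exists L : {set 'I_(n j)}, (1 - d1) * (n j)%:R <= #|L|%:R /\
      bowen_ball L (x j) e
        (iter (\sum_(i < k.+1 | (i < j)%N) (s i + n i))%N T y).

Definition strong_approx_product_structure : Prop :=
  forall e d1 d2 : R, 0 < e -> 0 < d1 -> 0 < d2 ->
  exists N : nat, forall (k : nat) (x : 'I_k.+1 -> X) (n : 'I_k.+1 -> nat),
    (forall j, 0 < n j)%N -> (forall j, N <= n j)%N ->
    exists y : X, approx_traces e d1 d2 x n y.

End approximate_product_structure.

(* Main.v *)
(** There are countably many Lipschitz test functions X -> [0, 1] such that every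
    lower semicontinuous function X -> [0, 1] is an increasing limit of some of
    them; they determine the weak* topology. An invariant measure mu is the
    barycenter of the empirical measures of any fixed length n at mu-random points, so mu is approximated by
    the average of finitely many orbit segments of length n, and no ergodic
    decomposition is needed. Given any sequence tau of invariant measures, the
    strong approximate product structure yields a point F(tau) that
    successively follows segments approximating tau_0, tau_1, ..., each stage
    being much longer than the previous ones: its empirical measures are close
    to tau_m at the end of stage m and close to the segment from tau_m to
    tau_(m+1) in between. Moreover F depends continuously on tau.

    As V is connected and separable, some sequence alpha in V with steps tending
    to 0 visits a dense subset of V and a boundary point alpha* infinitely often;
    let beta_q be invariant measures outside V converging to alpha*. For
    z : nat -> nat, replace alpha_m by beta_(z m) whenever alpha_m = alpha*. If z
    tends to infinity along these m, the limit measures of the resulting point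
    are exactly V; otherwise some beta_q is among them. This reduces the
    Pi03-complete set of divergent sequences to G_V and G(V). Similarly,
    visiting a dense subset of V infinitely often or only finitely often gives
    the Pi02-hardness of G^V. *)

From HB Require Import structures.
Require Import Defs.
From mathcomp Require Import all_boot all_order all_algebra.
From mathcomp Require Import all_classical all_reals all_analysis.
From mathcomp Require Import measurable_realfun ring lra zify.
Import Order.TTheory GRing.Theory Num.Theory.
Import numFieldNormedType.Exports.
Set Implicit Arguments.
Unset Strict Implicit.
Unset Printing Implicit Defensive.
Local Open Scope classical_set_scope.
Local Open Scope ring_scope.

(** * Baire space and reductions *)

(** The 2-adic valuation of n + 1 works: it equals j whenever n + 1 = 2^j * (2N + 1). *)
Lemma exists_infinitely_often_enum :
  exists c : nat -> nat, forall j N, exists2 n, (N <= n)%N & c n = j.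
Proof.
exists (fun n => logn 2 n.+1) => j N.
have p0 : (0 < 2 ^ j)%N by rewrite expn_gt0.
have q0 : (0 < 2 ^ j * N.*2.+1)%N by rewrite muln_gt0 p0.
exists (2 ^ j * N.*2.+1).-1; first by nia.
rewrite prednK// lognM// pfactorK// logn_coprime ?addn0//.
by rewrite coprime2n /= odd_double.
Qed.

Section baire_space.
Implicit Types (z : nat -> nat) (s : seq nat).
Local Open Scope nat_scope.

Definition cylinder s : set (nat -> nat) := [set z | mkseq z (size s) = s].

(** Openness in the Baire space, expressed by initial segments so that the constructions below
    handle finite words only. *)
Definition prefix_open (O : set (nat -> nat)) :=
  forall z, O z -> exists n, cylinder (mkseq z n) `<=` O.

Definition diverges_along (M : set nat) : set (nat -> nat) :=
  [set z | forall q, exists N, forall m, N <= m -> M m -> q <= z m].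

Lemma cylinder_nth s z i : cylinder s z -> i < size s -> z i = nth 0 s i.
Proof. by move=> sz si; rewrite -sz nth_mkseq. Qed.

Lemma cylinder_mkseqP z w n :
  cylinder (mkseq z n) w <-> (forall i, i < n -> w i = z i).
Proof.
split=> [zw i ni|zw].
  by rewrite (cylinder_nth zw) ?size_mkseq// nth_mkseq.
rewrite /cylinder/= size_mkseq; apply: (@eq_from_nth _ 0).
  by rewrite !size_mkseq.
by move=> i; rewrite size_mkseq => ni; rewrite !nth_mkseq// zw.
Qed.

Lemma cylinder_prefix s s' z : prefix s s' -> cylinder s' z -> cylinder s z.
Proof.
move=> /prefixP[t ->] sz; rewrite /cylinder/=; apply: (@eq_from_nth _ 0).
  by rewrite size_mkseq.
move=> i; rewrite size_mkseq => si; rewrite nth_mkseq// (cylinder_nth sz).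
  by rewrite nth_cat si.
by rewrite size_cat ltn_addr.
Qed.

Lemma cylinder_prefix_mkseq s z n : cylinder s z -> size s <= n ->
  prefix s (mkseq z n).
Proof.
move=> sz sn; apply/prefixP; exists (mkseq (fun i => z (size s + i)) (n - size s)).
apply: (@eq_from_nth _ 0); first by rewrite size_cat !size_mkseq subnKC.
move=> i; rewrite size_mkseq => ni; rewrite nth_mkseq// nth_cat.
case: ltnP => si; first exact: cylinder_nth.
by rewrite nth_mkseq ?subnKC// ltn_sub2r// (leq_ltn_trans si).
Qed.

(** The fusion argument shared by the Baire category proofs below: [I] is the invariant that permits
    the next extension, and [P n] records what the n-th extension achieves. *)
Lemma prefix_limit (I : set (seq nat)) (P : nat -> seq nat -> seq nat -> Prop)
    s0 : I s0 ->
  (forall n s, I s -> exists s', [/\ prefix s s', size s < size s', I s' &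
                                    P n s s']) ->
  exists z (u : nat -> seq nat), u 0 = s0 /\
    forall n, [/\ I (u n), P n (u n) (u n.+1), cylinder (u n) z & n <= size (u n)].
Proof.
move=> Is0 step.
have /choice[f fP] (ns : nat * seq nat) : exists s', I ns.2 ->
    [/\ prefix ns.2 s', size ns.2 < size s', I s' & P ns.1 ns.2 s'].
  have [/(step ns.1)[s' ?]|?] := pselect (I ns.2); first by exists s'.
  by exists [::].
pose u := fix u n := if n is p.+1 then f (p, u p) else s0.
have Iu n : I (u n) by elim: n => [|n ih]; [|have [] := fP (n, u n) ih].
have uP n := fP (n, u n) (Iu n).
have su n : n <= size (u n).
  by elim: n => //= n ih; have [_ + _ _] := uP n; exact: leq_ltn_trans.
have pu m n : m <= n -> prefix (u m) (u n).
  move=> /subnKC <-; elim: (n - m) => [|k ih]; first by rewrite addn0 ?prefix_refl ?leqnn.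
  by rewrite addnS; apply: prefix_trans ih _; case: (uP (m + k)).
(* Entry i is read off [u i.+1], whose length is at least i + 1. *)
exists (fun i => nth 0 (u i.+1) i), u; split => // n.
split=> //; first by case: (uP n).
apply: (@eq_from_nth _ 0); first by rewrite size_mkseq.
move=> i; rewrite size_mkseq => ni; rewrite nth_mkseq//.
have [/pu/prefixP[t ->]|/ltnW/pu/prefixP[t ->]] := leqP i.+1 n.
  by rewrite nth_cat su.
by rewrite nth_cat ni.
Qed.

(** A divergent sequence is built that dodges the G_delta sets one after the other. Stage n extends
    the word so that no point of its cylinder with later entries >= n lies in the n-th set; all
    entries added from then on are >= n. *)
Lemma diverges_along_not_bigcup_Gdelta (M : set nat)
    (O : nat -> nat -> set (nat -> nat)) :
  (forall N, exists2 m, N <= m & M m) -> (forall i j, prefix_open (O i j)) ->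
  diverges_along M <> \bigcup_i \bigcap_j O i j.
Proof.
move=> Minf openO eqM.
pose above K k z := forall i, k <= i -> K <= z i.
(* A G_delta subset of the divergent sequences is not dense in the closed set
   of extensions of s by entries >= K, since there the sequences taking the
   value K infinitely often are comeager. *)
have avoid i s K : exists s', [/\ prefix s s',
    forall j, size s <= j < size s' -> K <= nth 0 s' j &
    forall z, cylinder s' z -> above K (size s) z -> ~ (\bigcap_j O i j) z].
  apply: contrapT => /forallNP H.
  pose I := [set s' : seq nat | prefix s s' /\
    forall j, size s <= j < size s' -> K <= nth 0 s' j].
  have Is : I s by split=> [|j]; [exact: prefix_refl|lia].
  (* If every admissible word extended to a point of the G_delta set with entries >= K, the j-th
     step could enter [O i j] and then append K at a place in [M]. The limit would lie in the
     G_delta set without diverging along [M]. *)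
  pose P j (s1 s2 : seq nat) := cylinder s2 `<=` O i j /\
    exists m, [/\ size s1 <= m, m < size s2, M m & nth 0 s2 m = K].
  have [j s1 [ss1 Ks1]|z [u [u0 uP]]] := prefix_limit (P := P) Is.
    have [z [s1z zK /(_ j Logic.I) Oz]] : exists z,
        [/\ cylinder s1 z, above K (size s) z & (\bigcap_j O i j) z].
      apply: contrapT => /forallNP Hz; apply: (H s1).
      by split=> // z ? ? ?; exact: (Hz z).
    have [n nO] := openO _ _ _ Oz.
    have [m nm Mm] := Minf (maxn n (size s1)).
    move: nm; rewrite geq_max => /andP[nm sm].
    have szE : size (rcons (mkseq z m) K) = m.+1 by rewrite size_rcons size_mkseq.
    have pz : prefix s1 (rcons (mkseq z m) K).
      apply: prefix_trans (cylinder_prefix_mkseq s1z sm) _.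
      exact: prefix_rcons.
    exists (rcons (mkseq z m) K); split => //.
    - by rewrite szE ltnS.
    - split; first exact: prefix_trans pz.
      move=> k; rewrite szE nth_rcons size_mkseq => km.
      case: ltngtP => [km'|mk|_] //.
        by rewrite nth_mkseq//; apply: zK; lia.
      lia.
    - split; last first.
        by exists m; rewrite szE ltnS leqnn nth_rcons size_mkseq ltnn eqxx.
      apply: subset_trans nO => w /(cylinder_prefix (prefix_rcons _ _)).
      move=> /cylinder_mkseqP zw; apply/cylinder_mkseqP => k kn.
      by apply: zw; exact: leq_trans nm.
  have : diverges_along M z.
    rewrite eqM; exists i => // j _.
    have [_ [uO _] _ _] := uP j; apply: uO.
    by have [] := uP j.+1.
  move=> /(_ K.+1)[N NK].
  have [_ [_ [m [um mu Mm mK]]] _ Nu] := uP N.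
  have := NK m (leq_trans Nu um) Mm.
  by have [_ _ /cylinder_nth -> // _] := uP N.+1; rewrite mK ltnn.
have [//|n s _|z [u [u0 uP]]] := @prefix_limit setT (fun n s s' => prefix s s' /\
    [/\ forall j, size s <= j < size s' -> n <= nth 0 s' j &
    forall z, cylinder s' z -> above n (size s) z -> ~ (\bigcap_j O n j) z]) [::].
  have [s' [ss' H1 H2]] := avoid n s n.
  have ps : prefix s (rcons s' n) := prefix_trans ss' (prefix_rcons _ _).
  exists (rcons s' n); split => //.
    by rewrite size_rcons ltnS size_prefix.
  split => //; split.
    move=> j; rewrite size_rcons nth_rcons => js'; case: ltngtP => // js''.
      by apply: H1; lia.
    lia.
  by move=> z /(cylinder_prefix (prefix_rcons _ _)) /H2.
have su m n : m <= n -> size (u m) <= size (u n).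
  move=> /subnKC <-; elim: (n - m) => [|k ih]; first by rewrite addn0 ?prefix_refl ?leqnn.
  by rewrite addnS (leq_trans ih)// size_prefix//; case: (uP (m + k)) => _ [].
(* Position i belongs to the block added at some stage k >= n, where all entries are at least k. *)
have zn n : above n (size (u n)) z.
  move=> i ui.
  have [k [nk ki ik]] : exists k, [/\ n <= k, size (u k) <= i & i < size (u k.+1)].
    apply: contrapT => Hk.
    have : forall k, size (u (n + k)) <= i.
      elim=> [|k ih]; first by rewrite addn0.
      rewrite leqNgt; apply/negP => ik; apply: Hk; exists (n + k).
      by rewrite -addnS leq_addr.
    move=> /(_ i.+1); have [_ _ _ h] := uP (n + i.+1) => h'; lia.
  have [_ [_ [+ _]] _ _] := uP k; move=> /(_ i); rewrite ki ik => /(_ isT).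
  by have [_ _ /cylinder_nth -> // _] := uP k.+1; exact: leq_trans.
have : diverges_along M z.
  by move=> q; exists (size (u q)) => m qm _; exact: zn.
rewrite eqM => -[i _]; have [_ [_ [_ H]] _ _] := uP i.
by apply: H; [case: (uP i.+1)|exact: zn].
Qed.

(** If equality held, each [O i] would contain the eventually zero sequences and so be dense. A
    point of all the [O i] that takes every positive value infinitely often would then lie in [A]
    but outside the union. *)
Lemma infinitely_often_not_Fsigma (A : set (nat -> nat)) (O : nat -> set (nat -> nat)) :
  (forall i, prefix_open (O i)) ->
  (forall z, (forall n N, exists2 m, N <= m & z m = n.+1) -> A z) ->
  (forall z N, (forall m, N <= m -> z m = 0) -> ~ A z) ->
  A <> \bigcup_i ~` O i.
Proof.
move=> openO infA finA eqA.
have [c cP] := exists_infinitely_often_enum.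
have [//|n s _|z [u [u0 uP]]] := @prefix_limit setT (fun n s s' =>
    cylinder s' `<=` O n /\
    exists m, [/\ size s <= m, m < size s' & nth 0 s' m = (c n).+1]) [::].
  (* The default value of [nth] continues [s] by zeros, so this sequence is not in [A]. *)
  have Oz : O n (nth 0 s).
    apply: contrapT => nO.
    apply: (finA (nth 0 s) (size s)) => [m sm|]; first by rewrite nth_default.
    by rewrite eqA; exists n.
  have [k kO] := openO n _ Oz.
  pose m := maxn k (size s).
  have sm : size s <= m by exact: leq_maxr.
  have szE : size (rcons (mkseq (nth 0 s) m) (c n).+1) = m.+1.
    by rewrite size_rcons size_mkseq.
  exists (rcons (mkseq (nth 0 s) m) (c n).+1); split => //.
  - apply: prefix_trans (prefix_rcons _ _); apply: cylinder_prefix_mkseq => //.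
    by rewrite /cylinder/= mkseq_nth.
  - by rewrite szE ltnS.
  - split.
      apply: subset_trans kO => w /(cylinder_prefix (prefix_rcons _ _)).
      move=> /cylinder_mkseqP zw; apply/cylinder_mkseqP => i ik.
      by apply: zw; rewrite (leq_trans ik)// leq_maxl.
    by exists m; rewrite szE nth_rcons size_mkseq ltnn eqxx.
have : A z.
  apply: infA => n N.
  have [N' NN' cN'] := cP n N.
  have [_ [_ [m [um mu mE]]] _ _] := uP N'.
  exists m; first by case: (uP N') => _ _ _ h; lia.
  by have [_ _ /cylinder_nth -> // _] := uP N'.+1; rewrite mE cN'.
rewrite eqA => -[i _]; apply; have [_ [uO _] _ _] := uP i.
by apply: uO; case: (uP i.+1).
Qed.

End baire_space.

(** * Transfer of Borel complexity along a continuous map from the Baire space *)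

Section reduction.
Context {R : realType} {X : pseudoMetricType R}.
Variable f : (nat -> nat) -> X.
Local Open Scope nat_scope.
Hypothesis f_cont : forall e : R, (0 < e)%R -> exists n, forall z w,
  (forall i, i < n -> w i = z i) -> ball (f z) e (f w).

Lemma prefix_open_preimage (O : set X) : open O -> prefix_open (f @^-1` O).
Proof.
move=> oO z Oz; have /nbhs_ballP[e /= e0 eO] : nbhs (f z) O.
  exact: open_nbhs_nbhs.
have [n nf] := f_cont e0; exists n => w /cylinder_mkseqP zw.
exact/eO/nf.
Qed.

Lemma not_Sigma03_preimage (M : set nat) (A : set X) :
  (forall N, exists2 m, N <= m & M m) ->
  f @^-1` A = diverges_along M -> ~ Sigma0 3 A.
Proof.
move=> Minf fA [F [F2 AF]].
have /choice[H HP] i := F2 i.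
apply: (@diverges_along_not_bigcup_Gdelta M
  (fun i j => f @^-1` (~` H i j)) Minf).
  by move=> i j; apply: prefix_open_preimage; case: (HP i) => + _; exact.
rewrite -fA AF; apply/seteqP; split=> z [i _ Fz]; exists i => //=.
  move=> j _ /= Hz; have [_ HF] := HP i.
  by have : (~` F i) (f z) by rewrite HF; exists j.
apply: contrapT => nF; have [_ HF] := HP i.
have : (~` F i) (f z) by [].
by rewrite HF => -[j _]; exact: Fz.
Qed.

Lemma not_Sigma02_preimage (A : set X) :
  (forall z, (forall n N, exists2 m, N <= m & z m = n.+1) -> A (f z)) ->
  (forall z N, (forall m, N <= m -> z m = 0) -> ~ A (f z)) -> ~ Sigma0 2 A.
Proof.
move=> fA fnA [F [F1 AF]].
apply: (@infinitely_often_not_Fsigma (f @^-1` A) (fun i => f @^-1` (~` F i))) => //.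
  by move=> i; apply: prefix_open_preimage; exact: F1.
rewrite AF; apply/seteqP; split=> z [i _ Fz]; exists i => //=.
exact: contrapT.
Qed.

End reduction.

(** * Integrals of bounded Borel functions *)

Section mean.
Context {R : realType} {X : ptopologicalType}.
Implicit Types (mu nu : borel_prob R X) (f g h : X -> R).

Definition mean mu h : R := \int[mu]_x h x.

Definition borel_bounded h :=
  measurable_fun [set: borelType X] (h : borelType X -> R) /\
  exists M, forall x, `|h x| <= M.

(** Lower semicontinuity covers indicators of open sets as well as continuous functions, so one
    approximation result serves both separation and convergence. *)
Definition unit_lsc h :=
  (forall c, open [set x | c < h x]) /\ forall x, 0 <= h x <= 1.

Lemma lsc_measurable h : (forall c, open [set x | c < h x]) ->
  measurable_fun [set: borelType X] (h : borelType X -> R).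
Proof.
move=> lh _; apply: (measurability _ (RGenOInfty.measurableE R)) => //.
move=> /= _ [_ [c ->] <-]; apply: measurableI => //.
apply: sub_sigma_algebra; rewrite preimage_itvoy; exact: lh.
Qed.

Lemma continuous_lsc h : continuous h -> forall c, open [set x | c < h x].
Proof.
move=> ch c; rewrite (_ : [set x | _] = h @^-1` `]c, +oo[%classic); last first.
  by rewrite preimage_itvoy.
by move/continuousP : ch; apply; exact: rray_open.
Qed.

Lemma unit_lsc_borel h : unit_lsc h -> borel_bounded h.
Proof.
move=> [lh h01]; split; first exact: lsc_measurable.
by exists 1 => x; have /andP[h0 h1] := h01 x; rewrite ger0_norm.
Qed.

Lemma continuous_unit_lsc h : continuous h -> (forall x, 0 <= h x <= 1) ->
  unit_lsc h.
Proof. by move=> ch h01; split => //; exact: continuous_lsc. Qed.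

Lemma continuous_borel h M : continuous h -> (forall x, `|h x| <= M) ->
  borel_bounded h.
Proof.
move=> ch hM; split; last by exists M.
by apply: lsc_measurable; exact: continuous_lsc.
Qed.

Lemma borel_probT mu : mu [set: borelType X] = 1%E.
Proof. exact: (probability_setT (borel_prob_measure mu)). Qed.

Lemma borel_bounded_integrable mu h : borel_bounded h ->
  mu.-integrable [set: borelType X] (EFin \o (h : borelType X -> R)).
Proof.
move=> [mh [M hM]]; apply: measurable_bounded_integrable => //.
  by have /= -> := borel_probT mu; rewrite ltry.
exists M; split; first exact: num_real.
by move=> N MN x _; apply: le_trans (hM x) _; exact: ltW.
Qed.

Lemma EFin_mean mu h : borel_bounded h ->
  (\int[mu]_x (h x)%:E = (mean mu h)%:E)%E.
Proof.
move=> bh; rewrite /mean /Rintegral fineK//.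
by apply: integrable_fin_num => //; exact: borel_bounded_integrable.
Qed.

Lemma borel_bounded_cst (c : R) : borel_bounded (fun=> c).
Proof. by split; [exact: measurable_cst|exists `|c|]. Qed.

Lemma borel_boundedD f g : borel_bounded f -> borel_bounded g ->
  borel_bounded (fun x => f x + g x).
Proof.
move=> [mf [M fM]] [mg [N gN]]; split; first exact: measurable_funD.
by exists (M + N) => x; rewrite (le_trans (ler_normD _ _))// lerD.
Qed.

Lemma borel_boundedZ c f : borel_bounded f -> borel_bounded (fun x => c * f x).
Proof.
move=> [mf [M fM]]; split; first exact: measurable_funM.
by exists (`|c| * M) => x; rewrite normrM ler_wpM2l.
Qed.

Lemma borel_bounded_sum (I : Type) (s : seq I) (F : I -> X -> R) :
  (forall i, borel_bounded (F i)) -> borel_bounded (fun x => \sum_(i <- s) F i x).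
Proof.
move=> bF; elim: s => [|i s ih].
  by under eq_fun do rewrite big_nil; exact: borel_bounded_cst.
by under eq_fun do rewrite big_cons; exact: borel_boundedD.
Qed.

Lemma mean_cst mu c : mean mu (fun=> c) = c.
Proof. by rewrite /mean Rintegral_cst//; have /= -> := borel_probT mu; rewrite mulr1. Qed.

Lemma meanD mu f g : borel_bounded f -> borel_bounded g ->
  mean mu (fun x => f x + g x) = mean mu f + mean mu g.
Proof.
by move=> bf bg; rewrite /mean RintegralD//; exact: borel_bounded_integrable.
Qed.

Lemma meanZ mu c f : borel_bounded f ->
  mean mu (fun x => c * f x) = c * mean mu f.
Proof.
by move=> bf; rewrite /mean RintegralZl//; exact: borel_bounded_integrable.
Qed.

Lemma mean_sum mu (I : Type) (s : seq I) (F : I -> X -> R) :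
  (forall i, borel_bounded (F i)) ->
  mean mu (fun x => \sum_(i <- s) F i x) = \sum_(i <- s) mean mu (F i).
Proof.
move=> bF; elim: s => [|i s ih].
  by under eq_fun do rewrite big_nil; rewrite big_nil mean_cst.
under eq_fun do rewrite big_cons.
by rewrite big_cons meanD//; [rewrite ih|exact: borel_bounded_sum].
Qed.

Lemma le_mean mu f g : borel_bounded f -> borel_bounded g ->
  (forall x, f x <= g x) -> mean mu f <= mean mu g.
Proof.
move=> bf bg fg; apply: le_Rintegral => //; exact: borel_bounded_integrable.
Qed.

Lemma mean_ge0 mu f : (forall x, 0 <= f x) -> 0 <= mean mu f.
Proof. by move=> f0; exact: Rintegral_ge0. Qed.

Lemma mean_unit mu h : unit_lsc h -> 0 <= mean mu h <= 1.
Proof.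
move=> uh; have bh := unit_lsc_borel uh; case: uh => _ h01.
rewrite mean_ge0; last by move=> x; case/andP: (h01 x).
rewrite -(mean_cst mu 1) le_mean//; first exact: borel_bounded_cst.
by move=> x; case/andP: (h01 x).
Qed.

Lemma exists_lt_mean mu f e : borel_bounded f -> 0 < e ->
  exists x, f x < mean mu f + e.
Proof.
move=> bf e0; apply: contrapT => /forallNP fm.
suff : mean mu f + e <= mean mu f by rewrite gerDl leNgt e0.
rewrite -[leLHS](mean_cst mu) le_mean//; first exact: borel_bounded_cst.
by move=> x; rewrite leNgt; apply/negP; exact: fm.
Qed.

End mean.

(** * The weak* topology through integrals; mixtures and images of measures *)

Section weak_star.
Context {R : realType} {X : ptopologicalType}.
Implicit Types (mu nu : borel_prob R X) (f g h : X -> R).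

Lemma initial_cvgP (S : choiceType) (Y : topologicalType) (w : S -> Y)
    (F : set_system S) (s : S) : Filter F ->
  F --> (s : initial_topology w) <-> w @ F --> w s.
Proof.
move=> FF; split=> [Fs|Fs].
  exact: (cvg_trans (cvg_app w Fs) (@initial_continuous _ _ w s)).
move=> A /= [_ [[B Bop <-] Bs BA]].
have : nbhs (w s) B by apply: open_nbhs_nbhs.
by move=> /Fs FB; exact: (@filterS _ F FF _ _ BA FB).
Qed.

Lemma ptws_cvgP (I : Type) (Y : topologicalType) (F : set_system (I -> Y))
    (f : {ptws I -> Y}) : Filter F ->
  F --> f <-> forall i, (fun w => w i) @ F --> f i.
Proof.
move=> FF; rewrite cvg_sup; split=> H i; have := H i.
  by move/initial_cvgP; apply.
by move=> h; apply/initial_cvgP.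
Qed.

Lemma weak_starP (F : set_system (borel_prob R X)) mu : Filter F ->
  F --> mu <->
  forall h, continuous h -> (exists M, forall x, `|h x| <= M) ->
    mean nu h @[nu --> F] --> mean mu h.
Proof.
move=> FF; rewrite initial_cvgP ptws_cvgP; split=> H.
  move=> h ch [M hM].
  have bh : bounded_continuous h.
    split=> //; exists M; split; first exact: num_real.
    by move=> N MN x _; apply: le_trans (hM x) _; exact: ltW.
  by have := H (exist _ h (mem_set bh)).
move=> [h hP]; have [ch [M [_ hM]]] := set_mem hP.
apply: H => //; exists (M + 1) => x; apply: hM => //.
by rewrite ltrDl.
Qed.

Lemma mean_restrict (P : probability (borelType X) R) h :
  mean (borel_restrict P) h = \int[P]_x h x.
Proof.
rewrite /mean /Rintegral; congr fine; apply: eq_measure_integral => A mA _.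
by rewrite /= /borel_restrict_fun asboolT.
Qed.

Lemma mean_empirical (T : X -> X) x n h : borel_bounded h ->
  (forall x, 0 <= h x) ->
  mean (empirical T x n) h = n.+1%:R^-1 * \sum_(j < n.+1) h (iter j T x).
Proof.
move=> [mh _] h0; rewrite mean_restrict /Rintegral /empirical_fun.
have mEh : measurable_fun [set: borelType X] (EFin \o (h : borelType X -> R)).
  exact/measurable_EFinP.
rewrite ge0_integral_mscale//; last by move=> y _; rewrite lee_fin h0.
rewrite ge0_integral_measure_sum//; last by move=> y _; rewrite lee_fin h0.
rewrite (eq_bigr (fun j : 'I_n.+1 => (h (iter j T x))%:E)); last first.
  by move=> j _; rewrite integral_dirac// diracT mul1e.
by rewrite sumEFin.
Qed.

Section mixture.
Variables (mu nu : borel_prob R X) (s : R).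
Hypotheses (s0 : 0 <= s) (s1 : 0 <= 1 - s).
Local Open Scope ereal_scope.

Definition mixture_fun : set (borelType X) -> \bar R :=
  measure_add (mscale (NngNum s1) mu) (mscale (NngNum s0) nu).

HB.instance Definition _ := Measure.on mixture_fun.

Let mixtureT : mixture_fun setT = 1.
Proof.
rewrite /mixture_fun measure_addE /mscale.
transitivity ((1 - s)%:E * mu [set: borelType X] + s%:E * nu [set: borelType X]).
  by [].
by rewrite !borel_probT !mule1 -EFinD subrK.
Qed.

HB.instance Definition _ :=
  Measure_isProbability.Build _ _ _ mixture_fun mixtureT.

Definition mixture_prob : borel_prob R X := borel_restrict mixture_fun.

Lemma mixture_probE (A : set (borelType X)) : measurable A ->
  mixture_prob A = (1 - s)%:E * mu A + s%:E * nu A.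
Proof.
move=> mA; transitivity (mixture_fun A).
  by rewrite /= /borel_restrict_fun asboolT.
by rewrite /mixture_fun measure_addE.
Qed.

Lemma mean_mixture h : borel_bounded h -> (forall x, 0 <= h x)%R ->
  (mean mixture_prob h = (1 - s) * mean mu h + s * mean nu h)%R.
Proof.
move=> bh h0; have [mh _] := bh; rewrite mean_restrict /Rintegral /mixture_fun.
have mEh : measurable_fun [set: borelType X] (EFin \o (h : borelType X -> R)).
  exact/measurable_EFinP.
have Eh0 x : [set: borelType X] x -> 0 <= (EFin \o h) x by rewrite lee_fin h0.
rewrite (ge0_integral_measure_add _ _ _ Eh0)//.
rewrite !(ge0_integral_mscale _ _ _ mEh Eh0)//.
by rewrite !EFin_mean.
Qed.

End mixture.

Lemma continuous_borel_map (T : X -> X) : continuous T ->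
  measurable_fun [set: borelType X] (T : borelType X -> borelType X).
Proof.
move=> cT _.
apply: (@measurability _ _ (borelType X) (borelType X) _ _ (@open X)) => //.
move=> /= _ [B oB <-]; rewrite setTI; apply: sub_sigma_algebra.
by move/continuousP : cT; exact.
Qed.

Lemma borel_bounded_comp (T : X -> X) h : continuous T -> borel_bounded h ->
  borel_bounded (h \o T).
Proof.
move=> cT [mh [M hM]]; split; last by exists M => x; exact: hM.
exact: (measurableT_comp mh (continuous_borel_map cT)).
Qed.

Section image_prob.
Variables (T : X -> X) (cT : continuous T) (mu : borel_prob R X).

Let mT : {mfun borelType X >-> borelType X} :=
  HB.pack (T : borelType X -> borelType X)
    (isMeasurableFun.Build _ _ _ _ _ (continuous_borel_map cT)).

Definition image_prob : borel_prob R X := borel_restrict (distribution mu mT).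

Lemma image_probE (A : set (borelType X)) : measurable A ->
  image_prob A = mu (T @^-1` A).
Proof. by move=> mA; rewrite /= /borel_restrict_fun asboolT. Qed.

Lemma mean_image_prob h : borel_bounded h -> (forall x, 0 <= h x) ->
  mean image_prob h = mean mu (h \o T).
Proof.
move=> [mh _] h0; rewrite mean_restrict /mean /Rintegral; congr fine.
rewrite (@ge0_integral_distribution _ _ _ _ _ _ mT (EFin \o h))//.
exact/measurable_EFinP.
Qed.

(** Turns invariance into an equality of two measures, which can then be checked on test
    functions. *)
Lemma invariant_image_probP : invariant_probs T mu <-> image_prob = mu.
Proof.
rewrite borel_prob_eqP; split=> H A mA; last by rewrite -image_probE// H.
by rewrite image_probE// H.
Qed.

End image_prob.

Lemma mean_invariant (T : X -> X) mu h : continuous T -> invariant_probs T mu ->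
  borel_bounded h -> (forall x, 0 <= h x) -> mean mu (h \o T) = mean mu h.
Proof.
by move=> cT /(invariant_image_probP cT) iT bh h0; rewrite -mean_image_prob// iT.
Qed.

End weak_star.

(** * A countable convergence-determining family *)

Section test_functions.
Context {R : realType} {X : completeMetricType R}.
Variable e : nat -> X.
Hypothesis e_dense : forall x r, 0 < r -> exists p, mdist (e p) x < r.
Implicit Types (mu nu : borel_prob R X) (h : X -> R) (a : nat * rat * nat).

(** A truncated cone with centre in the dense sequence, rational height and integral slope: the
    parameters are countable. *)
Definition cone a (x : X) : R :=
  Num.max 0 (Num.min 1 (ratr a.1.2 - a.2%:R * mdist (e a.1.1) x)).

Definition cone_max (s : seq (nat * rat * nat)) (x : X) : R :=
  foldr (fun a m => Num.max (cone a x) m) 0 s.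

(** [k] codes a finite list of cones; a number that codes no list gives the zero function. *)
Definition test (k : nat) : X -> R := cone_max (odflt [::] (unpickle k)).

Lemma dist_max_le (a a' b b' L : R) : `|a - a'| <= L -> `|b - b'| <= L ->
  `|Num.max a b - Num.max a' b'| <= L.
Proof.
rewrite !ler_norml => /andP[? ?] /andP[? ?].
by case: (leP a b); case: (leP a' b') => ? ?; apply/andP; split; lra.
Qed.

Lemma dist_min_le (a a' b b' L : R) : `|a - a'| <= L -> `|b - b'| <= L ->
  `|Num.min a b - Num.min a' b'| <= L.
Proof.
rewrite !ler_norml => /andP[? ?] /andP[? ?].
by case: (leP a b); case: (leP a' b') => ? ?; apply/andP; split; lra.
Qed.

Lemma dist_mdist_le (x y z : X) : `|mdist z x - mdist z y| <= mdist x y.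
Proof.
have h1 := metric_triangle z x y; have h2 := metric_triangle z y x.
by rewrite (metric_sym y x) in h2; rewrite ler_norml; apply/andP; split; lra.
Qed.

Lemma cone_unit a x : 0 <= cone a x <= 1.
Proof.
by rewrite /cone le_max lexx/= ge_max ler01/= ge_min lexx.
Qed.

Lemma cone_lipschitz a x y : `|cone a x - cone a y| <= a.2%:R * mdist x y.
Proof.
have d0 : 0 <= a.2%:R * mdist x y by rewrite mulr_ge0// mdist_ge0.
apply: dist_max_le; first by rewrite subrr normr0.
apply: dist_min_le; first by rewrite subrr normr0.
rewrite [X in `|X|](_ : _ = a.2%:R * (mdist (e a.1.1) y - mdist (e a.1.1) x)).
  by rewrite normrM ger0_norm// ler_wpM2l// (metric_sym x); exact: dist_mdist_le.
by ring.
Qed.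

Lemma cone_max_unit s x : 0 <= cone_max s x <= 1.
Proof.
elim: s => [|a s /andP[h0 h1]]/=; first by rewrite lexx ler01.
have /andP[c0 c1] := cone_unit a x.
by rewrite le_max c0 ge_max c1 h1.
Qed.

Lemma cone_max_cat s t x : cone_max s x <= cone_max (s ++ t) x.
Proof.
elim: s => [|a s ih] /=; first by case/andP: (cone_max_unit t x).
by rewrite ge_max le_max lexx/= le_max ih orbT.
Qed.

Lemma test_unit k x : 0 <= test k x <= 1.
Proof. exact: cone_max_unit. Qed.

Lemma test_lipschitz k : exists2 L, 0 <= L &
  forall x y, `|test k x - test k y| <= L * mdist x y.
Proof.
rewrite /test; elim: (odflt _ _) => [|a s [L L0 sL]].
  by exists 0 => // x y; rewrite subrr normr0 mul0r.
exists (L + a.2%:R); first by rewrite addr_ge0.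
move=> x y /=; have d0 := mdist_ge0 x y; apply: dist_max_le.
  by rewrite (le_trans (cone_lipschitz _ _ _))// mulrDl lerDr mulr_ge0.
by rewrite (le_trans (sL _ _))// mulrDl lerDl mulr_ge0.
Qed.

Lemma test_continuous k : continuous (test k).
Proof.
have [L L0 kL] := test_lipschitz k.
move=> x; apply/cvgrPdist_lt => r r0; apply/nbhs_ballP.
exists (r / (L + 1)) => /=; first by rewrite divr_gt0// ltr_wpDl.
move=> y; rewrite ballEmdist/= ltr_pdivlMr ?ltr_wpDl// => xy.
apply: le_lt_trans (kL x y) _; apply: le_lt_trans xy.
by rewrite mulrC ler_wpM2l ?mdist_ge0// lerDl.
Qed.

Lemma test_lsc k : unit_lsc (test k).
Proof. by apply: continuous_unit_lsc; [exact: test_continuous|exact: test_unit]. Qed.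

Lemma test_borel k : borel_bounded (test k).
Proof. exact/unit_lsc_borel/test_lsc. Qed.

(** Take a rational q with c < q < h x and a ball of radius r around x on which h > q. A cone of
    height q never exceeds h inside the ball. With slope above 2 / r and centre within r / 2 of x,
    it vanishes outside the ball; with the centre still closer to x, it exceeds c at x. *)
Lemma cone_below h x c : unit_lsc h -> c < h x ->
  exists a, (forall y, cone a y <= h y) /\ c < cone a x.
Proof.
move=> [lh h01] chx.
(* For negative c the zero cone suffices; otherwise q is positive. *)
have [c0|c0] := ltP c 0.
  have cone0 y : cone (0%N, 0%Q, 0%N) y = 0.
    by rewrite /cone/= rmorph0 mul0r subr0 min_r ?ler01// maxxx.
  exists (0%N, 0%Q, 0%N); split=> [y|]; rewrite cone0//.
  by case/andP: (h01 y).
have [q /andP[cq qh]] : exists q : rat, c < ratr q < h x.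
  by have [q] := rat_in_itvoo chx; rewrite in_itv/=; exists q.
have : nbhs x [set y | ratr q < h y] by apply: open_nbhs_nbhs; split; first exact: lh.
move=> /nbhs_ballP[r /= r0 rh].
pose n := (Num.truncn (2 / r)).+1.
have nr : 1 < n%:R * (r / 2).
  by rewrite -ltr_pdivrMr ?divr_gt0// mul1r invf_div truncnS_gt.
have n0 : 0 < n%:R :> R by rewrite ltr0n.
have [p px] : exists p, mdist (e p) x < Num.min (r / 2) ((ratr q - c) / n%:R).
  by apply: e_dense; rewrite lt_min !divr_gt0// subr_gt0.
move: px; rewrite lt_min => /andP[pr pc].
have h1 y : h y <= 1 by case/andP: (h01 y).
exists (p, q, n); split => [y|]; rewrite /cone/=.
  have [hy|hy] := ltP (ratr q) (h y).
    rewrite ge_max; apply/andP; split; first by case/andP: (h01 y).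
    rewrite ge_min; apply/orP; right; apply: le_trans (ltW hy).
    by rewrite gerBl mulr_ge0 ?mdist_ge0// ltW.
  rewrite max_l; first by case/andP: (h01 y).
  rewrite ge_min; apply/orP; right; rewrite subr_le0.
  have : ~ ball x r y by move=> /rh/=; rewrite ltNge hy.
  rewrite ballEmdist/= => /negP; rewrite -leNgt => xy.
  have py : r / 2 <= mdist (e p) y.
    have := metric_triangle x (e p) y; rewrite (metric_sym x (e p)) => ?; lra.
  rewrite (le_trans (ltW qh))// (le_trans (h1 x))// (le_trans (ltW nr))//.
  by rewrite ler_wpM2l// ltW.
have npc : n%:R * mdist (e p) x < ratr q - c by rewrite mulrC -ltr_pdivlMr.
rewrite lt_max; apply/orP; right; rewrite lt_min; apply/andP; split; last lra.
by rewrite (lt_le_trans chx).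
Qed.

(** The n-th function is the maximum of those cones below [h] whose code is less than n; by
    [cone_below] nothing smaller than [h] bounds them all. *)
Lemma test_approx_below h : unit_lsc h -> exists k : nat -> nat,
  [/\ forall n x, test (k n) x <= h x,
      forall x, {homo (fun n => test (k n) x) : m n / (m <= n)%N >-> m <= n} &
      forall x c, c < h x -> exists n, c < test (k n) x].
Proof.
move=> uh; have [_ h01] := uh.
pose l n := [seq a <- pmap (@unpickle (nat * rat * nat)%type) (iota 0 n) |
  `[< forall y, cone a y <= h y >] ].
have testl n x : test (pickle (l n)) x = cone_max (l n) x by rewrite /test pickleK.
exists (fun n => pickle (l n)); split.
- move=> n x; rewrite testl /l; elim: (pmap _ _) => [|a s ih]/=.
    by case/andP: (h01 x).
  by case: asboolP => //= ax; rewrite ge_max ax.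
- move=> x; apply: homo_leq => // [? ? ?|n]; first exact: le_trans.
  rewrite !testl /l -addn1 iotaD pmap_cat filter_cat.
  exact: cone_max_cat.
- move=> x c chx; have [a [ah ca]] := cone_below uh chx.
  exists (pickle a).+1; rewrite testl.
  have : a \in l (pickle a).+1.
    rewrite mem_filter; apply/andP; split; first exact/asboolP.
    by rewrite mem_pmap; apply/mapP; exists (pickle a);
      rewrite ?mem_iota ?add0n ?ltnSn ?pickleK.
  elim: (l _) => //= b s ih; rewrite inE lt_max => /orP[/eqP <-|/ih ->].
    by rewrite ca.
  by rewrite orbT.
Qed.

Lemma mean_approx_below mu h r : unit_lsc h -> 0 < r ->
  exists k, (forall x, test k x <= h x) /\ mean mu h - r < mean mu (test k).
Proof.
move=> uh r0; have [k [kh knd ksup]] := test_approx_below uh.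
have [_ h01] := uh.
pose G n (x : borelType X) := (test (k n) x)%:E.
have mG n : measurable_fun [set: borelType X] (G n).
  by apply/measurable_EFinP; case: (test_borel (k n)).
have G0 n x : [set: borelType X] x -> (0 <= G n x)%E.
  by rewrite lee_fin; case/andP: (test_unit (k n) x).
have ndG x : [set: borelType X] x ->
    {homo G^~ x : n m / (n <= m)%N >-> (n <= m)%E}.
  by move=> _ m n mn; rewrite lee_fin knd.
have := cvg_monotone_convergence (mu := mu) measurableT mG G0 ndG.
have -> : (fun x => limn (G^~ x)) = (fun x => (h x)%:E).
  apply/funext => x; apply/cvg_lim => //.
  apply: cvg_EFin; first exact: nearW.
  apply/cvgrPdist_le => d d0.
  have [n nd] := ksup x (h x - d) ltac:(by rewrite ltrBlDr ltrDl).
  exists n => // m /= nm.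
  have := knd x _ _ nm; have := kh m x => h1 h2.
  by rewrite ger0_norm ?subr_ge0//; lra.
rewrite EFin_mean; last exact: unit_lsc_borel.
have -> : (fun n => \int[mu]_x G n x)%E = EFin \o (fun n => mean mu (test (k n))).
  by apply/funext => n; exact/EFin_mean/test_borel.
move=> /fine_cvgP[_].
move=> /cvgrPdist_lt /(_ _ r0)[n _ /(_ n (leqnn n))] /= hn.
exists (k n); split => //; move: hn; rewrite ltr_norml => /andP[_]; lra.
Qed.

Lemma mean_le_of_test mu nu h : (forall k, mean mu (test k) = mean nu (test k)) ->
  unit_lsc h -> mean mu h <= mean nu h.
Proof.
move=> munu uh; apply/ler_addgt0Pr => r r0.
have [k [kh kr]] := mean_approx_below mu uh r0.
have := le_mean nu (test_borel k) (unit_lsc_borel uh) kh.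
rewrite -munu; lra.
Qed.

(** Approximation from below carries the equality of means over to indicators of open sets, and
    these sets form a generating family closed under intersection. *)
Lemma test_separating mu nu : (forall k, mean mu (test k) = mean nu (test k)) ->
  mu = nu.
Proof.
move=> munu; apply/borel_prob_eqP.
have munuG (G : set X) : open G -> mu G = nu G.
  move=> oG; have uG : unit_lsc (\1_G : X -> R).
    split=> [c|x]; last by rewrite indicE; case: (_ \in _); rewrite ?lexx ?ler01.
    have [c0|c0] := ltP c 0.
      rewrite (_ : [set x | _] = setT); first exact: openT.
      by apply/seteqP; split=> x//= _; rewrite (lt_le_trans c0).
    have [c1|c1] := ltP c 1.
      rewrite (_ : [set x | _] = G)//; apply/seteqP; split=> x/=; rewrite indicE.
        by case: (boolP (x \in G)) => [/set_mem//|_]; rewrite ltNge c0.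
      by move=> /mem_set ->.
    rewrite (_ : [set x | _] = set0); first exact: open0.
    apply/seteqP; split=> x//=; rewrite indicE; case: (_ \in _).
      by rewrite ltNge c1.
    by rewrite ltNge c0.
  have mG : measurable (G : set (borelType X)) by exact: sub_sigma_algebra.
  have meanG (m : borel_prob R X) : m G = (mean m (\1_G : X -> R))%:E.
    rewrite -EFin_mean; last exact: unit_lsc_borel.
    by rewrite integral_indic// setIT.
  rewrite !meanG; congr EFin; apply/eqP; rewrite eq_le !mean_le_of_test//.
apply: (@measure_unique _ R (borelType X) (@open X) (fun=> setT)).
- by [].
- by move=> A B; exact: openI.
- by move=> _; exact: openT.
- by rewrite bigcup_const.
- exact: munuG.
- by move=> _; have /= -> := borel_probT mu; rewrite ltry.
Qed.

(** As in the portmanteau theorem, approximation from below gives a liminf inequality for every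
    [unit_lsc] function. A bounded continuous [h] is rescaled to f with values in [0, 1], and the
    inequality is applied to f and to 1 - f. *)
Lemma test_weak_starP (u : nat -> borel_prob R X) mu :
  u n @[n --> \oo] --> mu <->
  forall k, mean (u n) (test k) @[n --> \oo] --> mean mu (test k).
Proof.
rewrite weak_starP; split=> [H k|H h ch [M hM]].
  apply: H; first exact: test_continuous.
  exists 1 => x; have /andP[h0 h1] := test_unit k x.
  by rewrite ger0_norm.
rewrite -[X in X --> _]/(mean (u n) h @[n --> \oo]).
have liminf f : unit_lsc f -> forall r, 0 < r ->
    \forall n \near \oo, mean mu f - r < mean (u n) f.
  move=> uf r r0; have r20 : 0 < r / 2 by rewrite divr_gt0.
  have [k [kf kr]] := mean_approx_below mu uf r20.
  have /cvgrPdist_lt/(_ _ r20) := H k; apply: filterS => n.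
  have := le_mean (u n) (test_borel k) (unit_lsc_borel uf) kf.
  rewrite ltr_norml => ? /andP[_]; lra.
pose C := Num.max 1 M.
have C0 : 0 < C by rewrite lt_max ltr01.
have hC x : - C <= h x <= C.
  by rewrite -ler_norml (le_trans (hM x))// le_max lexx orbT.
pose f x := (2 * C)^-1 * (h x + C).
have cf : continuous f.
  move=> x; apply: cvgMr; apply: cvgD; first exact: ch.
  exact: cvg_cst.
have C20 : 0 < 2 * C by rewrite mulr_gt0.
have f01 x : 0 <= f x <= 1.
  have /andP[h1 h2] := hC x.
  apply/andP; split; last by rewrite /f mulrC ler_pdivrMr// mul1r; lra.
  by rewrite mulr_ge0 ?invr_ge0 ?(ltW C20)//; lra.
have uf : unit_lsc f by exact: continuous_unit_lsc.
have uf' : unit_lsc (fun x => 1 + (-1) * f x).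
  apply: continuous_unit_lsc.
    move=> x; apply: cvgD; first exact: cvg_cst.
    by apply: cvgMr; exact: cf.
  by move=> x; have /andP[? ?] := f01 x; apply/andP; split; lra.
have bf := unit_lsc_borel uf.
have mean1f nu : mean nu (fun x => 1 + (-1) * f x) = 1 - mean nu f.
  rewrite meanD; [|exact: borel_bounded_cst|exact: borel_boundedZ].
  by rewrite mean_cst meanZ// mulN1r.
have bh : borel_bounded h by exact: continuous_borel ch hM.
have meanh nu : mean nu h = 2 * C * mean nu f - C.
  have bC : borel_bounded (fun _ : X => C) := borel_bounded_cst C.
  rewrite /f meanZ ?meanD ?mean_cst//; last exact: borel_boundedD.
  by rewrite mulrA divff ?gt_eqF// mul1r addrK.
under eq_fun do rewrite meanh; rewrite meanh.
apply: cvgD; last exact: cvg_cst.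
apply: cvgMr; apply/cvgrPdist_lt => r r0.
have := liminf _ uf _ r0; have := liminf _ uf' _ r0.
apply: filterS2 => n; rewrite !mean1f ltr_norml => ? ?; apply/andP; split; lra.
Qed.

End test_functions.

(** * Chains and dense sequences of measures *)

Section test_close.
Context {R : realType} {X : completeMetricType R}.
Variable e : nat -> X.
Hypothesis e_dense : forall x r, 0 < r -> exists p, mdist (e p) x < r.
Implicit Types (mu nu : borel_prob R X) (V : set (borel_prob R X)).

(** The index [k] governs both the number of tests and the tolerance, so these relations stand in
    for a metric on measures. *)
Definition test_close k mu nu := forall i, (i < k)%N ->
  `|mean mu (test e i) - mean nu (test e i)| < k.+1%:R^-1.

Lemma invSn_gt0 k : 0 < k.+1%:R^-1 :> R.
Proof. by rewrite invr_gt0. Qed.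

Lemma invSn_le m n : (m <= n)%N -> n.+1%:R^-1 <= m.+1%:R^-1 :> R.
Proof. by move=> mn; rewrite lef_pV2 ?posrE// ler_nat. Qed.

Lemma invSn_lt (r : R) : 0 < r -> exists n, n.+1%:R^-1 < r.
Proof.
move=> r0; exists (Num.truncn r^-1).
by rewrite invf_plt ?posrE// truncnS_gt.
Qed.

Lemma test_close_refl k mu : test_close k mu mu.
Proof. by move=> i _; rewrite subrr normr0 invSn_gt0. Qed.

Lemma test_close_sym k mu nu : test_close k mu nu -> test_close k nu mu.
Proof. by move=> H i /H; rewrite distrC. Qed.

Lemma test_close_le m n mu nu : (m <= n)%N -> test_close n mu nu -> test_close m mu nu.
Proof.
move=> mn H i im; apply: lt_le_trans (H i (leq_trans im mn)) _; exact: invSn_le.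
Qed.

(** The index 2k + 1 halves the tolerance: 1/(2k + 2) + 1/(2k + 2) = 1/(k + 1). *)
Lemma test_close_trans k mu nu rho :
  test_close k.*2.+1 mu nu -> test_close k.*2.+1 nu rho ->
  test_close k mu rho.
Proof.
move=> H1 H2 i ik; have i2 : (i < k.*2.+1)%N by lia.
have -> : k.+1%:R^-1 = k.*2.+2%:R^-1 + k.*2.+2%:R^-1 :> R.
  rewrite (_ : k.*2.+2 = (k.+1 * 2)%N); last lia.
  by rewrite natrM invfM -mulrDr -[X in X * _]mulr1 -mulrA; field.
have := H2 i i2; have := H1 i i2; move: (k.*2.+2%:R^-1) => r.
rewrite !ltr_norml => /andP[? ?] /andP[? ?].
by apply/andP; split; lra.
Qed.

Lemma test_close_cvgP (u : nat -> borel_prob R X) mu :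
  u n @[n --> \oo] --> mu <-> forall k, \forall n \near \oo, test_close k (u n) mu.
Proof.
rewrite (test_weak_starP e_dense); split=> H k.
  suff : forall j, \forall n \near \oo, forall i, (i < j)%N ->
      `|mean (u n) (test e i) - mean mu (test e i)| < k.+1%:R^-1 by exact.
  elim=> [|j ih]; first by apply: nearW => ?.
  have /cvgrPdist_lt/(_ _ (invSn_gt0 k)) := H j.
  apply: filterS2 ih => n ih nj i; rewrite ltnS leq_eqVlt.
  by move=> /orP[/eqP->|]; [rewrite distrC|exact: ih].
apply/cvgrPdist_lt => r r0; have [n nr] := invSn_lt r0.
apply: filterS (H (maxn n k.+1)) => m /(_ k).
rewrite leq_max ltnSn orbT distrC => /(_ isT) /lt_trans; apply.
by apply: le_lt_trans nr; apply: invSn_le; exact: leq_maxl.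
Qed.

Lemma test_close_separating mu nu : (forall k, test_close k mu nu) -> mu = nu.
Proof.
move=> H; apply: (test_separating e_dense) => k; apply/eqP.
rewrite -subr_eq0 -normr_le0; apply/ler_addgt0Pr => r r0; rewrite add0r.
have [n nr] := invSn_lt r0.
have := H (maxn n k.+1) k; rewrite leq_max ltnSn orbT => /(_ isT) /ltW.
move=> /le_trans; apply; apply: le_trans (ltW nr).
by apply: invSn_le; exact: leq_maxl.
Qed.

Lemma test_close_nbhs k mu : nbhs mu [set nu | test_close k mu nu].
Proof.
have H i : mean nu (test e i) @[nu --> mu] --> mean mu (test e i).
  apply: (proj1 (weak_starP mu (nbhs_filter mu))) => //.
    exact: test_continuous.
  exists 1 => x; have /andP[h0 h1] := test_unit e i x.
  by rewrite ger0_norm.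
suff : forall j, \forall nu \near mu, forall i, (i < j)%N ->
    `|mean mu (test e i) - mean nu (test e i)| < k.+1%:R^-1 by exact.
have FF : Filter (nbhs mu) by exact: nbhs_filter.
elim=> [|j ih]; first by apply: filterE => ?.
have /cvgrPdist_lt/(_ _ (invSn_gt0 k)) := H j.
apply: filterS2 ih => n ih nj i; rewrite ltnS leq_eqVlt => /orP[/eqP->|] //.
exact: ih.
Qed.

(** For each finite list of rationals, a member of [V] is picked whose test means approximate the
    list, if there is one, and a fixed member otherwise. There are countably many lists. *)
Lemma exists_dense_sequence V : V !=set0 -> exists d : nat -> borel_prob R X,
  (forall n, V (d n)) /\ forall mu k, V mu -> exists n, test_close k (d n) mu.
Proof.
move=> [a0 Va0].
pose approx (p : nat * seq rat) mu := forall i, (i < p.1)%N ->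
  `|mean mu (test e i) - ratr (nth 0 p.2 i)| < p.1.*2.+2%:R^-1.
have /choice[f fP] (p : nat * seq rat) : exists mu, V mu /\
    ((exists2 nu, V nu & approx p nu) -> approx p mu).
  have [[nu Vnu pnu]|np] := pselect (exists2 nu, V nu & approx p nu).
    by exists nu.
  by exists a0; split=> // /np.
exists (fun n => f (odflt (0%N, [::]) (unpickle n))); split.
  by move=> n; case: (fP (odflt (0%N, [::]) (unpickle n))).
move=> mu k Vmu.
have [q qP] : exists q : nat -> rat, forall i,
    `|mean mu (test e i) - ratr (q i)| < k.*2.+2%:R^-1.
  suff /choice[q qP] : forall i, exists q : rat,
      `|mean mu (test e i) - ratr q| < k.*2.+2%:R^-1 by exists q.
  move=> i; have : mean mu (test e i) < mean mu (test e i) + k.*2.+2%:R^-1.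
    by rewrite ltrDl invSn_gt0.
  move=> /rat_in_itvoo[q]; rewrite in_itv/= => /andP[q1 q2]; exists q.
  by rewrite distrC ger0_norm ?subr_ge0 1?ltW// ltrBlDl.
pose p := (k, mkseq q k).
exists (pickle p); rewrite pickleK/=.
have [_ fp] := fP p.
have pmu : approx p mu by move=> i ik; rewrite nth_mkseq.
have {}fp : approx p (f p) by apply: fp; exists mu.
move=> i ik; have := fp i ik; have := pmu i ik; rewrite /= nth_mkseq//.
have -> : k.+1%:R^-1 = k.*2.+2%:R^-1 + k.*2.+2%:R^-1 :> R.
  rewrite (_ : k.*2.+2 = (k.+1 * 2)%N); last lia.
  by rewrite natrM invfM -mulrDr -[X in X * _]mulr1 -mulrA; field.
move: (k.*2.+2%:R^-1) => r; rewrite !ltr_norml => /andP[? ?] /andP[? ?].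
by apply/andP; split; lra.
Qed.

Definition chain V k mu nu := exists n (p : nat -> borel_prob R X),
  [/\ p 0%N = mu, p n = nu, forall j, V (p j) &
      forall j, (j < n)%N -> test_close k (p j) (p j.+1)].

Lemma chain_rcons V k mu nu rho : chain V k mu nu -> V rho -> test_close k nu rho ->
  chain V k mu rho.
Proof.
move=> [n [p [p0 pn pV pc]]] Vrho nurho.
exists n.+1, (fun j => if (j <= n)%N then p j else rho); split.
- by rewrite leq0n.
- by rewrite ltnn.
- by move=> j; case: ifP.
- move=> j; rewrite ltnS => jn; rewrite jn; case: ifP => [|/negbT] jn'.
    exact: pc.
  by rewrite (_ : j = n) ?pn//; lia.
Qed.

(** The members of [V] reachable from [mu] by a [k]-chain form a nonempty subset that is both open
    and closed in [V]. *)
Lemma connected_chain V k mu nu : connected V -> V mu -> V nu -> chain V k mu nu.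
Proof.
move=> cV Vmu Vnu.
(* Interiors are taken because [test_close_nbhs] provides neighbourhoods, not open sets. *)
pose O (B : set (borel_prob R X)) := \bigcup_(rho in B) [set nu | test_close k rho nu]°.
have openO B : open (O B) by apply: bigcup_open => rho _; exact: open_interior.
have subO B : B `<=` O B.
  by move=> rho Brho; exists rho => //; exact: test_close_nbhs.
pose B := [set rho | V rho /\ chain V k mu rho].
suff BV : B = V by have [] : B nu by rewrite BV.
apply: cV.
- exists mu; split=> //; exists 0%N, (fun=> mu); split=> // j.
- exists (O B) => //; apply/seteqP; split=> rho.
    by move=> Brho; split; [case: Brho|exact: subO].
  move=> [Vrho [sigma [Vs cs] /interior_subset/= src]]; split => //.
  exact: chain_rcons cs Vrho src.
- exists (~` O (V `\` B)); first exact: open_closedC.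
  apply/seteqP; split=> rho.
    move=> [Vrho crho]; split => // -[sigma [Vs nBs] /interior_subset/= src].
    by apply: nBs; split => //; apply: chain_rcons crho Vs _; exact: test_close_sym.
  move=> [Vrho nO]; apply: contrapT => nB; apply: nO; exact: subO.
Qed.

(** Concatenates, for n = 0, 1, ..., an [n]-chain in [V] from [d n] to [d n.+1]. *)
Lemma exists_schedule V (d : nat -> borel_prob R X) :
  connected V -> (forall n, V (d n)) ->
  exists alpha : nat -> borel_prob R X,
    [/\ forall m, V (alpha m),
        forall k, \forall m \near \oo, test_close k (alpha m) (alpha m.+1) &
        forall n, exists2 m, (n <= m)%N & alpha m = d n].
Proof.
move=> cV Vd.
have /choice[len /choice[p pP]] n : exists len, exists p : nat -> borel_prob R X,
    [/\ p 0%N = d n, p len = d n.+1, forall j, V (p j) &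
      forall j, (j < len)%N -> test_close n (p j) (p j.+1)].
  exact: connected_chain.
(* A state is a chain number with a position in that chain. Passing to the next chain repeats the
   measure reached, so this step has size zero. *)
pose next (s : nat * nat) := if (s.2 < len s.1)%N then (s.1, s.2.+1) else (s.1.+1, 0%N).
pose st m := iter m next (0%N, 0%N).
have st_le m : ((st m).2 <= len (st m).1)%N.
  by elim: m => //= m ih; rewrite /next; case: ifP.
have st_mono m m' : (m <= m')%N -> ((st m).1 <= (st m').1)%N.
  move=> /subnKC <-; elim: (m' - m)%N => [|k ih]; first by rewrite addn0.
  by rewrite addnS /= (leq_trans ih)// /next; case: ifP.
have st_hit n : exists2 m, (n <= m)%N & st m = (n, 0%N).
  elim: n => [|n [m nm mE]]; first by exists 0%N.
  have stj j : (j <= len n)%N -> st (m + j)%N = (n, j).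
    elim: j => [|j ih] jn; first by rewrite addn0.
    by rewrite addnS/= -/(st _) ih ?(ltnW jn)// /next/= jn.
  exists (m + len n).+1; first by lia.
  by rewrite /= -/(st _) stj// /next/= ltnn.
exists (fun m => p (st m).1 (st m).2); split.
- by move=> m; case: (pP (st m).1).
- move=> k; have [m _ mE] := st_hit k; exists m => // m' /= mm'.
  have km' : (k <= (st m').1)%N by have := st_mono _ _ mm'; rewrite mE.
  rewrite -/(st _) /next; have := st_le m'; rewrite leq_eqVlt.
  have [p0 pn pV pc] := pP (st m').1.
  case: ltnP => [lt _|le].
    by apply: test_close_le km' _; exact: pc.
  rewrite orbF => /eqP ->/=; have [p0' _ _ _] := pP (st m').1.+1.
  by rewrite pn p0'; exact: test_close_refl.
- move=> n; have [m nm mE] := st_hit n; exists m => //.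
  by rewrite mE; case: (pP n).
Qed.

End test_close.

(** * Limit measures of an orbit *)

Lemma open_forall_lt (Y : topologicalType) (P : nat -> set Y) j :
  (forall i, open (P i)) -> open [set x | forall i, (i < j)%N -> P i x].
Proof.
move=> oP; elim: j => [|j ih].
  by rewrite (_ : [set x | _] = setT); [exact: openT|apply/seteqP; split].
rewrite (_ : [set x | _] = [set x | forall i, (i < j)%N -> P i x] `&` P j).
  exact: openI.
apply/seteqP; split=> x /= => [H|[H Pj] i].
  by split=> [i ij|]; apply: H => //; exact: ltnW.
by rewrite ltnS leq_eqVlt => /orP[/eqP->//|]; exact: H.
Qed.

Section limit_measures.
Context {R : realType} {X : completeMetricType R}.
Variable e : nat -> X.
Hypothesis e_dense : forall x r, 0 < r -> exists p, mdist (e p) x < r.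
Variable T : X -> X.
Hypothesis T_continuous : continuous T.
Implicit Types (mu nu : borel_prob R X) (V : set (borel_prob R X)).

Notation MT := (invariant_probs T : set (borel_prob R X)).
Notation E x n := (empirical T x n : borel_prob R X).
Notation close := (test_close e).

Lemma iter_continuous j : continuous (iter j T).
Proof.
elim: j => [|j ih] x /=; first exact: cvg_id.
by apply: continuous_comp; [exact: ih|exact: T_continuous].
Qed.

Lemma mean_empirical_test x n k :
  mean (E x n) (test e k) = n.+1%:R^-1 * \sum_(j < n.+1) test e k (iter j T x).
Proof.
apply: mean_empirical; first exact: test_borel.
by move=> y; case/andP: (test_unit e k y).
Qed.

Lemma mean_empirical_continuous n k :
  continuous (fun x => mean (E x n) (test e k)).
Proof.
under eq_fun do rewrite mean_empirical_test.
move=> x; apply: cvgMr.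
elim: n.+1 => [|m ih].
  by under eq_fun do rewrite big_ord0; rewrite big_ord0; exact: cvg_cst.
under eq_fun do rewrite big_ord_recr; rewrite big_ord_recr/=.
apply: cvgD => //; apply: continuous_comp; first exact: iter_continuous.
exact: test_continuous.
Qed.

Lemma limit_measuresP x mu : limit_measures T x mu <->
  forall k N, exists2 t, (N <= t)%N & close k (E x t) mu.
Proof.
split=> [[phi [phi_incr /(test_close_cvgP e_dense) phiP]] k N|H].
  have phi_ge n : (n <= phi n)%N.
    by elim: n => // n ih; apply: leq_ltn_trans ih _; exact: phi_incr.
  have [M _ MP] := phiP k.
  exists (phi (maxn N M)); first by rewrite (leq_trans (leq_maxl N M)).
  by apply: MP; rewrite /= leq_maxr.
have /choice[f fP] (p : nat * nat) : exists t, (p.2 <= t)%N /\ close p.1 (E x t) mu.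
  by have [t ? ?] := H p.1 p.2; exists t.
pose phi := fix phi n := if n is m.+1 then f (n, (phi m).+1) else f (0, 0)%N.
exists phi; split.
  apply: homo_ltn; first by move=> ? ? ?; exact: ltn_trans.
  by move=> n /=; case: (fP (n.+1, (phi n).+1)).
apply/(test_close_cvgP e_dense) => k; exists k => // n /= kn.
apply: (test_close_le kn); case: n {kn} => [|n] /=; first by case: (fP (0, 0)%N).
by case: (fP (n.+1, (phi n).+1)).
Qed.

(** The empirical means of f o T and of f differ by a telescoping sum divided by the length, which
    tends to 0 for bounded f. *)
Lemma limit_measures_invariant x : limit_measures T x `<=` MT.
Proof.
move=> mu [phi [phi_incr phiP]].
have phi_ge n : (n <= phi n)%N.
  by elim: n => // n ih; apply: leq_ltn_trans ih _; exact: phi_incr.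
apply/(invariant_image_probP T_continuous); apply: (test_separating e_dense) => k.
have h0 y : 0 <= test e k y by case/andP: (test_unit e k y).
have h1 y : test e k y <= 1 by case/andP: (test_unit e k y).
rewrite mean_image_prob//; last exact: test_borel.
have c1 : mean (E x (phi n)) (test e k) @[n --> \oo] --> mean mu (test e k).
  by move/(test_weak_starP e_dense): phiP; exact.
have c2 : mean (E x (phi n)) (test e k \o T) @[n --> \oo] -->
    mean mu (test e k \o T).
  move/weak_starP : phiP; apply.
    move=> y; apply: continuous_comp; first exact: T_continuous.
    exact: test_continuous.
  by exists 1 => y; rewrite ger0_norm/=.
apply/eqP; rewrite -subr_eq0; apply/eqP.
apply: (@cvg_unique _ (@Rhausdorff R) _ _ _ _ (cvgB c2 c1)).
apply/cvgrPdist_lt => r r0; have [N Nr] := invSn_lt r0.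
exists N => // n /= Nn; rewrite sub0r normrN.
rewrite -[X in `|X|]/(mean (E x (phi n)) (test e k \o T) -
  mean (E x (phi n)) (test e k)).
rewrite mean_empirical_test mean_empirical//=; last first.
  by apply: borel_bounded_comp => //; exact: test_borel.
rewrite -mulrBr -sumrB -(big_mkord xpredT (fun i => test e k (iter i.+1 T x) -
  test e k (iter i T x))) telescope_sumr// normrM ger0_norm ?invr_ge0//.
apply: le_lt_trans Nr; apply: le_trans (invSn_le (leq_trans Nn (phi_ge n))).
rewrite ler_piMr ?invr_ge0//= ler_norml.
have := h0 x; have := h1 x; have := h0 (T (iter (phi n) T x)).
by have := h1 (T (iter (phi n) T x)) => ? ? ? ?; apply/andP; split; lra.
Qed.

(** A point is not generic iff, for some test k and some q, the k-th mean is off by more than 1/(q +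
    1) at infinitely many times. For fixed k and q this is a G_delta condition. *)
Lemma generic_Pi03 mu : Pi0 3 (generic T mu).
Proof.
pose O k N : set X := \bigcup_(n in [set n | (N <= n)%N])
  [set x | k.2.+1%:R^-1 < `|mean mu (test e k.1) - mean (E x n) (test e k.1)|].
have openO k N : open (O k N).
  apply: bigcup_open => n _; apply: continuous_lsc => x.
  apply: cvg_norm; apply: cvgB; first exact: cvg_cst.
  exact: mean_empirical_continuous.
exists (fun j => \bigcap_N O (odflt (0, 0)%N (unpickle j)) N); split.
  move=> j; exists (fun N => ~` O (odflt (0, 0)%N (unpickle j)) N); split.
    by move=> N; rewrite /= setCK.
  by rewrite setC_bigcap.
apply/seteqP; split=> [x ngx|x [j _]].
  apply: contrapT => nO; apply: ngx; apply/(test_weak_starP e_dense) => k.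
  apply/cvgrPdist_lt => r r0; have [q qr] := invSn_lt r0.
  apply: contrapT => nN; apply: nO; exists (pickle (k, q)) => //.
  rewrite pickleK/= => N _; apply: contrapT => nON; apply: nN.
  exists N => // n /= Nn; apply: le_lt_trans qr; rewrite leNgt; apply/negP => qn.
  by apply: nON; exists n.
move: (odflt _ _) => [k q] HO /(test_weak_starP e_dense) /(_ k) /cvgrPdist_lt.
move=> /(_ _ (invSn_gt0 q))[N _ NP]; have [n /= Nn] := HO N Logic.I.
by have /= := NP n Nn; move=> /lt_trans/[apply]; rewrite ltxx.
Qed.

(** It suffices that the empirical measures come close, at every precision and infinitely often, to
    each term of a dense sequence in [V]: countably many open conditions. *)
Lemma G_upper_Pi02 V : V !=set0 -> Pi0 2 (G_upper T V).
Proof.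
move=> /(exists_dense_sequence e)[d [Vd dP]].
pose O (p : nat * nat * nat) : set X := \bigcup_(t in [set t | (p.2 <= t)%N])
  [set x | close p.1.2 (E x t) (d p.1.1)].
have openO p : open (O p).
  apply: bigcup_open => t _; apply: open_forall_lt => i.
  rewrite [X in open X](_ : _ = [set x | - p.1.2.+1%:R^-1 <
    - `|mean (E x t) (test e i) - mean (d p.1.1) (test e i)|]); last first.
    by apply/seteqP; split=> x /=; rewrite ltrN2.
  apply: continuous_lsc => x.
  apply: cvgN; apply: cvg_norm; apply: cvgB; last exact: cvg_cst.
  exact: mean_empirical_continuous.
exists (fun j => ~` O (odflt (0, 0, 0)%N (unpickle j))); split.
  by move=> j; rewrite /= setCK.
rewrite -setC_bigcap; congr (~` _); apply/seteqP; split=> x.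
  move=> xV j _; move: (odflt _ _) => [[n k] N].
  by have /limit_measuresP/(_ k N)[t Nt tP] := xV _ (Vd n); exists t.
move=> xO mu Vmu; apply/limit_measuresP => k N.
have [n nP] := dP mu k.*2.+1 Vmu.
have := xO (pickle (n, k.*2.+1, N)) Logic.I; rewrite pickleK/= => -[t /= Nt tP].
by exists t => //; exact: test_close_trans tP nP.
Qed.

Lemma closed_subspace_limit V (u : nat -> borel_prob R X) mu :
  V `<=` MT -> closed (V : set (subspace MT)) -> (forall n, V (u n)) -> MT mu ->
  (forall k, \forall n \near \oo, close k (u n) mu) -> V mu.
Proof.
move=> VM /closed_subspaceP[C clC CV] Vu Mmu /(test_close_cvgP e_dense) umu.
suff : (V `&` MT) mu by case.
rewrite -CV; split => //.
apply: (closed_cvg C clC _ mu umu); apply: nearW => n.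
by have [] : (C `&` MT) (u n) by rewrite CV; split => //; exact/VM/Vu.
Qed.

Section segment.
Variables mu nu : borel_prob R X.

(** Clipping keeps the weights nonnegative, so that [segment] is defined for every real
    parameter. *)
Definition clip01 (s : R) := Num.max 0 (Num.min 1 s).

Lemma clip01_ge0 s : 0 <= clip01 s.
Proof. by rewrite le_max lexx. Qed.

Lemma clip01_le1 s : 0 <= 1 - clip01 s.
Proof. by rewrite subr_ge0 ge_max ler01 ge_min lexx. Qed.

Lemma clip01_id s : 0 <= s <= 1 -> clip01 s = s.
Proof. by move=> /andP[s0 s1]; rewrite /clip01 min_r// max_r. Qed.

Definition segment s := mixture_prob mu nu (clip01_ge0 s) (clip01_le1 s).

Lemma mean_segment s k : 0 <= s <= 1 -> mean (segment s) (test e k) =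
  (1 - s) * mean mu (test e k) + s * mean nu (test e k).
Proof.
move=> s01; rewrite mean_mixture ?clip01_id//; first exact: test_borel.
by move=> y; case/andP: (test_unit e k y).
Qed.

Lemma segment0 : segment 0 = mu.
Proof.
apply: (test_separating e_dense) => k.
by rewrite mean_segment ?lexx ?ler01// subr0 mul1r mul0r addr0.
Qed.

Lemma segment1 : segment 1 = nu.
Proof.
apply: (test_separating e_dense) => k.
by rewrite mean_segment ?lexx ?ler01// subrr mul1r mul0r add0r.
Qed.

Lemma segment_invariant s : MT mu -> MT nu -> MT (segment s).
Proof.
move=> Mmu Mnu A mA; have mTA : measurable (T @^-1` A : set (borelType X)).
  have := continuous_borel_map T_continuous measurableT mA.
  by rewrite setTI.
by rewrite !mixture_probE// Mmu// Mnu.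
Qed.

Lemma segment_close k s t : 0 <= s <= 1 -> 0 <= t <= 1 ->
  `|s - t| < k.+1%:R^-1 -> close k (segment s) (segment t).
Proof.
move=> s01 t01 st i _; rewrite !mean_segment//; apply: le_lt_trans st.
have -> : (1 - s) * mean mu (test e i) + s * mean nu (test e i) -
  ((1 - t) * mean mu (test e i) + t * mean nu (test e i)) =
  (s - t) * (mean nu (test e i) - mean mu (test e i)) by ring.
rewrite normrM ler_piMr// ler_norml.
have /andP[? ?] := mean_unit mu (test_lsc e i).
have /andP[? ?] := mean_unit nu (test_lsc e i).
by apply/andP; split; lra.
Qed.

End segment.

(** On the segment from a point of [V] to an invariant measure outside [V], let s be the supremum of
    the parameters lying in [V]. It is attained because [V] is closed, and every larger parameter in
    [0, 1] gives a measure outside [V]. *)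
Lemma exists_boundary_sequence V : V `<=` MT -> closed (V : set (subspace MT)) ->
  V !=set0 -> MT `\` V !=set0 ->
  exists alpha (beta : nat -> borel_prob R X),
    [/\ V alpha, forall q, (MT `\` V) (beta q) &
        forall k q, (k <= q)%N -> close k (beta q) alpha].
Proof.
move=> VM clV [mu Vmu] [nu [Mnu nVnu]].
pose S := [set s : R | 0 <= s <= 1 /\ V (segment mu nu s)].
have S0 : S 0 by split; [rewrite lexx ler01|rewrite segment0].
have supS : has_sup S.
  by split; [exists 0|exists 1 => s [/andP[]]].
set s := sup S.
have s01 : 0 <= s <= 1.
  rewrite ub_le_sup//=; last by case: supS.
  by apply: ge_sup; [exists 0|move=> ? [/andP[]]].
have Mseg t : MT (segment mu nu t) by apply: segment_invariant => //; exact: VM.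
have Vs : V (segment mu nu s).
  have /choice[u uP] n : exists t, S t /\ `|t - s| < n.+1%:R^-1.
    have [t St st] := sup_adherent (invSn_gt0 n) supS.
    exists t; split => //; rewrite distrC ger0_norm ?subr_ge0; last first.
      by apply: ub_le_sup => //; case: supS.
    by rewrite ltrBlDl -ltrBlDr.
  apply: (closed_subspace_limit (u := fun n => segment mu nu (u n))) => //.
    by move=> n; case: (uP n) => -[].
  move=> k; exists k => // n /= kn; have [[u01 _] us] := uP n.
  by apply: segment_close => //; apply: lt_le_trans us _; exact: invSn_le.
have s1 : s < 1.
  rewrite lt_neqAle; have /andP[_ ->] := s01; rewrite andbT; apply/eqP => s1.
  by apply: nVnu; rewrite -(segment1 mu nu) -s1.
(* With q + 2 in the denominator the distance to s stays strictly below 1/(k + 1) for all k <= q. *)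
pose t q := s + (1 - s) * q.+2%:R^-1.
have q0 q : 0 < q.+2%:R^-1 :> R by rewrite invr_gt0.
have q1 q : q.+2%:R^-1 <= 1 :> R by rewrite invf_le1// ler1n.
have t01 q : 0 <= t q <= 1.
  rewrite /t; have := q0 q; have := q1 q; move: (q.+2%:R^-1) => r r1 r0.
  case/andP: s01 => ? ?; apply/andP; split; nra.
exists (segment mu nu s), (fun q => segment mu nu (t q)); split => //.
- move=> q; split => // Vt.
  have : t q <= s by apply: ub_le_sup => //; case: supS.
  by rewrite /t gerDl leNgt mulr_gt0// subr_gt0.
- move=> k q kq; apply: segment_close => //.
  rewrite /t addrC addKr ger0_norm; last by rewrite mulr_ge0// ?subr_ge0 ltW.
  apply: (@le_lt_trans _ _ q.+2%:R^-1).
    by rewrite ler_piMl ?(ltW (q0 q))//; case/andP: s01 => ? ?; lra.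
  by rewrite ltf_pV2 ?posrE// ltr_nat ltnS.
Qed.

End limit_measures.

(** * Tracing orbit segments *)

Section tracing.
Context {R : realType} {X : completeMetricType R}.
Variable T : X -> X.
Implicit Types (mu : borel_prob R X) (h : X -> R).

(** A derandomised law of large numbers. The inner product of the accumulated error with the next
    deviation has mean 0, so some point makes it less than 1/2. The squared norm then grows by at
    most 2 * (1/2) + k per step. *)
Lemma greedy_average mu k (G : nat -> X -> R) r :
  (forall i, borel_bounded (G i)) -> (forall i x, 0 <= G i x <= 1) ->
  exists s : seq X, size s = r /\
    \sum_(i < k) (\sum_(x <- s) (G i x - mean mu (G i))) ^+ 2 <= r%:R * k.+1%:R.
Proof.
move=> bG G01; elim: r => [|r [s [sr ih]]].
  exists [::]; split => //; rewrite mul0r big1// => i _.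
  by rewrite big_nil expr0n.
pose S (i : 'I_k) := \sum_(x <- s) (G i x - mean mu (G i)).
have bF i : borel_bounded (fun x => S i * G i x) by exact: borel_boundedZ.
have half0 : 0 < 2^-1 :> R by rewrite invr_gt0.
have [x xP] := exists_lt_mean mu (borel_bounded_sum (index_enum _) bF) half0.
exists (x :: s); split; first by rewrite /= sr.
rewrite mean_sum// in xP.
have {}xP : \sum_(i < k) S i * (G i x - mean mu (G i)) < 2^-1.
  under eq_bigr do rewrite mulrBr.
  rewrite sumrB ltrBlDl; apply: lt_le_trans xP _.
  by rewrite lerD2r ler_sum// => i _; rewrite meanZ.
apply: (@le_trans _ _ (\sum_(i < k) (S i ^+ 2 +
    (2 * (S i * (G i x - mean mu (G i))) + 1)))).
  apply: ler_sum => i _; rewrite big_cons -/(S i).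
  have /andP[g0 g1] := G01 i x.
  have /andP[m0 m1] : 0 <= mean mu (G i) <= 1.
    rewrite mean_ge0 => [|y]; last by case/andP: (G01 i y).
    rewrite -(mean_cst mu 1) le_mean//; first exact: borel_bounded_cst.
    by move=> y; case/andP: (G01 i y).
  move: (G i x) (mean mu _) (S i) g0 g1 m0 m1 => g m c *; nra.
rewrite big_split/= big_split/= -mulr_sumr sumr_const card_ord.
apply: (@le_trans _ _ (r%:R * k.+1%:R + (2 * 2^-1 + k%:R))).
  by rewrite lerD// lerD2r ler_pM2l// ltW.
by rewrite mulfV ?pnatr_eq0// -[r.+1]addn1 natrD mulrDl mul1r nat1r.
Qed.

Lemma exists_average mu k (G : nat -> X -> R) kap :
  (forall i, borel_bounded (G i)) -> (forall i x, 0 <= G i x <= 1) -> 0 < kap ->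
  exists s : seq X, (0 < size s)%N /\ forall i, (i < k)%N ->
    `|\sum_(x <- s) G i x - (size s)%:R * mean mu (G i)| <= (size s)%:R * kap.
Proof.
move=> bG G01 kap0.
(* This r satisfies r * (k + 1) <= (r * kap)^2, which turns the quadratic bound into the required
   one. *)
pose r := (Num.truncn (k.+1%:R / kap ^+ 2)).+1.
have r0 : 0 < r%:R :> R by rewrite ltr0n.
have rP : k.+1%:R <= r%:R * kap ^+ 2.
  by rewrite -ler_pdivrMr ?exprn_gt0// ltW// truncnS_gt.
have [s [sr sP]] := greedy_average mu k r bG G01.
exists s; rewrite sr; split => // i ik.
have -> : \sum_(x <- s) G i x - r%:R * mean mu (G i) =
    \sum_(x <- s) (G i x - mean mu (G i)).
  by rewrite sumrB big_const_seq count_predT sr iter_addr_0 mulr_natl.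
rewrite -ler_sqr ?nnegrE ?mulr_ge0 ?(ltW kap0)// real_normK ?num_real//.
apply: (@le_trans _ _ (r%:R * k.+1%:R)).
  apply: le_trans sP; rewrite (bigD1 (Ordinal ik))//= lerDl.
  by apply: sumr_ge0 => j _; exact: sqr_ge0.
by rewrite exprMn expr2 -mulrA ler_pM2l.
Qed.

Definition birkhoff h t x : R := \sum_(0 <= j < t) h (iter j T x).

Lemma birkhoffD h a b x :
  birkhoff h (a + b) x = birkhoff h a x + birkhoff h b (iter a T x).
Proof.
rewrite /birkhoff (@big_cat_nat _ _ _ a)//= ?leq_addr//; congr (_ + _).
rewrite -{1}[a]add0n big_addn addKn; apply: eq_bigr => j _.
by rewrite iterD.
Qed.

Lemma birkhoff_unit h t x : (forall x, 0 <= h x <= 1) ->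
  0 <= birkhoff h t x <= t%:R.
Proof.
move=> h01; apply/andP; split.
  by apply: sumr_ge0 => j _; case/andP: (h01 (iter j T x)).
rewrite -[leRHS]mulr1 -[t in leRHS]subn0 mulr_natl -sumr_const_nat.
by apply: ler_sum => j _; case/andP: (h01 (iter j T x)).
Qed.

Lemma birkhoff_dist h t x y kap :
  (forall j, (j < t)%N -> `|h (iter j T x) - h (iter j T y)| <= kap) ->
  `|birkhoff h t x - birkhoff h t y| <= t%:R * kap.
Proof.
move=> H; rewrite -sumrB (le_trans (ler_norm_sum _ _ _))//.
rewrite -[t in leRHS]subn0 mulr_natl -sumr_const_nat.
by apply: ler_sum_nat => j /andP[_]; exact: H.
Qed.

Lemma birkhoff_dist_subset h n (A : {set 'I_n}) x y kap del :
  (forall x, 0 <= h x <= 1) -> 0 <= kap -> (1 - del) * n%:R <= #|A|%:R ->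
  (forall i, i \in A -> `|h (iter i T x) - h (iter i T y)| <= kap) ->
  `|birkhoff h n x - birkhoff h n y| <= n%:R * (kap + del).
Proof.
move=> h01 kap0 cA H; rewrite -sumrB (le_trans (ler_norm_sum _ _ _))//.
rewrite big_mkord (bigID (mem A))/=.
have h1 : \sum_(i < n | i \in A) `|h (iter i T x) - h (iter i T y)| <= n%:R * kap.
  apply: (@le_trans _ _ (\sum_(i < n | i \in A) kap)); first exact: ler_sum.
  rewrite sumr_const -[kap *+ _]mulr_natl ler_wpM2r// ler_nat.
  by rewrite (leq_trans (max_card _))// card_ord.
have h2 : \sum_(i < n | i \notin A) `|h (iter i T x) - h (iter i T y)| <= n%:R - #|A|%:R.
  apply: (@le_trans _ _ (\sum_(i < n | i \notin A) 1)).
    apply: ler_sum => i _; have /andP[? ?] := h01 (iter i T x).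
    by have /andP[? ?] := h01 (iter i T y); rewrite ler_norml; apply/andP; split; lra.
  rewrite sumr_const -[X in _ <= X - _]/(n%:R).
  rewrite (_ : #|_| = (n - #|A|)%N).
    by rewrite natrB// (leq_trans (max_card _))// card_ord.
  by rewrite -[X in (X - _)%N](card_ord n) -(cardC A) addKn.
by apply: le_trans (lerD h1 h2) _; move: (#|A|%:R) cA => c; nra.
Qed.

(** Time at which j pieces of length [n], each preceded by its gap, are completed after an initial
    segment of length [L]. *)
Definition piece_end (L n : nat) (gap : nat -> nat) j :=
  (L + \sum_(i < j) (gap i + n))%N.

(** The first term of a specification is traced at all of its times and without delay. Putting the
    orbit segment of [y] there lets a later stage preserve what earlier stages achieved. *)
Lemma saps_trace (eps del : R) : strong_approx_product_structure T ->
  0 < eps -> 0 < del ->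
  exists N, forall (y : X) L (w : nat -> X) n k,
    (N <= L)%N -> (0 < L)%N -> (N <= n)%N -> (0 < n)%N ->
  exists y' (gap : nat -> nat),
    (forall q, (q < L)%N -> mdist (iter q T y) (iter q T y') < eps) /\
    forall j, (j < k)%N -> (gap j)%:R <= del * n%:R /\
      exists A : {set 'I_n}, (1 - del) * n%:R <= #|A|%:R /\
        forall i, i \in A -> mdist (iter i T (w j))
          (iter i T (iter (piece_end L n gap j + gap j)%N T y')) < eps.
Proof.
move=> saps eps0 del0; have [N NP] := saps _ _ _ eps0 del0 del0.
exists N => y L w n k NL L0 Nn n0.
pose xx (j : 'I_k.+1) := if val j is i.+1 then w i else y.
pose nn (j : nat) := if j is i.+1 then n else L.
have [||y' [y'L [gap gapP]]] := NP k xx (fun j => nn j).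
- by case=> -[].
- by case=> -[].
exists y', gap; split.
  by move=> q qL; apply: (y'L (Ordinal qL)); rewrite inE.
move=> j jk; have jk1 : (j.+1 < k.+1)%N by [].
have [gj [A [cA HA]]] := gapP (Ordinal jk1) isT.
split => //; exists A; split => // i /HA /=.
suff -> : (\sum_(i < k.+1 | i < j.+1) (gap i + nn i))%N =
  (piece_end L n gap j + gap j)%N by [].
rewrite -(big_ord_widen k.+1 (fun i => gap i + nn i)%N); last by lia.
elim: j {jk jk1 gj A cA HA i} => [|j ih].
  by rewrite big_ord_recl big_ord0 /piece_end big_ord0/=; lia.
by rewrite big_ord_recr/= ih /piece_end big_ord_recr/=; lia.
Qed.

(** * Birkhoff sums along a periodically repeated list of orbit segments *)

Section estimate.
Variables (h : X -> R) (eps kap : R) (y' : X) (L n k : nat).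
Variables (w : nat -> X) (gap : nat -> nat).
Hypotheses (h01 : forall x, 0 <= h x <= 1) (kap01 : 0 < kap <= 1).
Hypothesis osc : forall x y, mdist x y < eps -> `|h x - h y| <= kap.
Hypothesis trace : forall j, (j < k)%N -> (gap j)%:R <= kap * n%:R /\
  exists A : {set 'I_n}, (1 - kap) * n%:R <= #|A|%:R /\
    forall i, i \in A -> mdist (iter i T (w j))
      (iter i T (iter (piece_end L n gap j + gap j)%N T y')) < eps.

Let pe := piece_end L n gap.

Lemma piece_endS j : pe j.+1 = (pe j + (gap j + n))%N.
Proof. by rewrite /pe /piece_end big_ord_recr/= addnA. Qed.

(** Each piece contributes three errors of at most n * kap: the oscillation of [h] at traced times,
    the untraced times, and the gap. *)
Lemma birkhoff_pieces J : (J <= k)%N ->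
  `|birkhoff h (pe J) y' - birkhoff h L y' - \sum_(j < J) birkhoff h n (w j)| <=
  J%:R * n%:R * (3 * kap).
Proof.
have /andP[kap0 kap1] := kap01.
elim: J => [_|J ih Jk].
  by rewrite big_ord0 /pe /piece_end big_ord0 addn0 subrr subr0 normr0 !mul0r.
have {}ih := ih (ltnW Jk).
have [gJ [A [cA HA]]] := trace Jk.
rewrite big_ord_recr/= piece_endS birkhoffD birkhoffD -iterD (addnC (gap J) (pe J)).
have /andP[g0 g1] := birkhoff_unit (gap J) (iter (pe J) T y') h01.
have := birkhoff_dist_subset h01 (ltW kap0) cA (fun i iA => osc (HA i iA)).
rewrite -/pe => H.
rewrite -natr1.
move: ih H; rewrite !ler_norml => /andP[? ?] /andP[? ?].
by apply/andP; split; lra.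
Qed.

Lemma piece_end_bounds J : (J <= k)%N ->
  J%:R * n%:R <= (pe J)%:R - L%:R :> R /\
  (pe J)%:R - L%:R <= J%:R * n%:R * (1 + kap).
Proof.
elim: J => [_|J ih Jk].
  by rewrite /pe /piece_end big_ord0 addn0 subrr !mul0r.
have [h1 h2] := ih (ltnW Jk); have [gJ _] := trace Jk.
have g0 : 0 <= (gap J)%:R :> R by [].
rewrite piece_endS (natrD _ (pe J)) (natrD _ (gap J)) -natr1.
by split; nra.
Qed.

Lemma exists_piece t : (L <= t)%N -> (t <= pe k)%N ->
  exists J, [/\ (J <= k)%N, (pe J <= t)%N & (t <= pe J + 2 * n)%N].
Proof.
move=> Lt; have /andP[kap0 kap1] := kap01.
suff : forall J, (J <= k)%N -> (t <= pe J)%N ->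
  exists J, [/\ (J <= k)%N, (pe J <= t)%N & (t <= pe J + 2 * n)%N] by apply.
elim=> [_|J ih Jk] tJ.
  exists 0%N; split => //; first by rewrite /pe /piece_end big_ord0 addn0.
  by rewrite (leq_trans tJ)// leq_addr.
have [/(ih (ltnW Jk))//|Jt] := leqP t (pe J).
exists J; split; [exact: ltnW|exact: ltnW|rewrite (leq_trans tJ)//].
rewrite piece_endS leq_add2l; have [gJ _] := trace Jk.
suff : (gap J <= n)%N by lia.
rewrite -(ler_nat R); apply: le_trans gJ _.
by rewrite ler_piMl.
Qed.

Variables (s : seq X) (x0 : X) (v : R).
Hypotheses (s0 : (0 < size s)%N) (v01 : 0 <= v <= 1).
Hypothesis wE : forall j, w j = nth x0 s (j %% size s).
Hypothesis sv : `|\sum_(x <- s) birkhoff h n x - (size s)%:R * n%:R * v| <=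
  (size s)%:R * n%:R * kap.

(** The deviations are periodic in j with period [size s]. Complete cycles are controlled by [sv],
    and the incomplete one is bounded trivially. *)
Lemma birkhoff_cycle J :
  `|\sum_(j < J) birkhoff h n (w j) - J%:R * n%:R * v| <=
  J%:R * n%:R * kap + (size s)%:R * n%:R.
Proof.
have /andP[kap0 kap1] := kap01; have /andP[v0 v1] := v01.
pose r := size s; pose F j := birkhoff h n (w j) - n%:R * v.
have FE m : \sum_(j < m) birkhoff h n (w j) - m%:R * n%:R * v = \sum_(0 <= j < m) F j.
  by rewrite big_mkord sumrB sumr_const card_ord mulr_natl -mulrnAl.
have F1 j : `|F j| <= n%:R.
  have /andP[b0 b1] := birkhoff_unit n (w j) h01.
  have n0 : 0 <= n%:R :> R by [].
  by rewrite /F ler_norml; apply/andP; split; nra.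
have Fr j : F (j + r)%N = F j by rewrite /F !wE modnDr.
have FC : \sum_(0 <= j < r) F j = \sum_(x <- s) birkhoff h n x - r%:R * n%:R * v.
  rewrite -FE; congr (_ - _); rewrite (big_nth x0) big_mkord.
  by apply: eq_bigr => i _; rewrite wE modn_small.
have FK q : \sum_(0 <= j < q * r) F j = q%:R * \sum_(0 <= j < r) F j.
  elim: q => [|q ih]; first by rewrite mul0n big_geq// mul0r.
  rewrite mulSn (@big_cat_nat _ _ _ r)//= ?leq_addr// -{2}[r]add0n big_addn addKn.
  under [X in _ + X]eq_bigr do rewrite Fr.
  by rewrite ih -nat1r mulrDl mul1r.
rewrite FE (divn_eq J r) (@big_cat_nat _ _ _ (J %/ r * r)%N)//= ?leq_addr//.
apply: le_trans (ler_normD _ _) _; apply: lerD.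
  rewrite FK FC normrM ger0_norm//.
  apply: (@le_trans _ _ ((J %/ r)%:R * (r%:R * n%:R * kap))); first by rewrite ler_wpM2l.
  rewrite !mulrA -natrM ler_wpM2r ?(ltW kap0)// ler_wpM2r// ler_nat.
  by rewrite leq_addr.
apply: le_trans (ler_norm_sum _ _ _) _.
apply: (@le_trans _ _ (\sum_((J %/ r * r)%N <= j < (J %/ r * r + J %% r)%N) n%:R)).
  by apply: ler_sum => j _; exact: F1.
rewrite sumr_const_nat addKn -[leLHS]mulr_natl ler_wpM2r// ler_nat ltnW//.
by rewrite ltn_mod.
Qed.

(** The factor 5 collects 3 from tracing, 1 from the cycle average and 1 from the time spent in
    gaps. The additive constant absorbs the last incomplete piece and cycle; it does not depend on
    the number [k] of pieces. *)
Lemma birkhoff_estimate t : (L <= t)%N -> (t <= pe k)%N ->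
  `|birkhoff h t y' - birkhoff h L y' - (t%:R - L%:R) * v| <=
  (t%:R - L%:R) * (5 * kap) + 5 * (size s)%:R * n%:R.
Proof.
move=> Lt tk; have [J [Jk Jt tJ]] := exists_piece Lt tk.
have /andP[kap0 kap1] := kap01; have /andP[v0 v1] := v01.
have H1 := birkhoff_pieces Jk; have H2 := birkhoff_cycle J.
have [H3 H4] := piece_end_bounds Jk.
have tE : t = (pe J + (t - pe J))%N by rewrite subnKC.
have := birkhoffD h (pe J) (t - pe J) y'; rewrite -tE => H5.
have /andP[H6 H7] := birkhoff_unit (t - pe J) (iter (pe J) T y') h01.
rewrite natrB// in H7.
have H8 : (pe J)%:R <= t%:R :> R by rewrite ler_nat.
have H9 : t%:R <= (pe J)%:R + 2 * n%:R :> R by rewrite -natrM -natrD ler_nat.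
have r1 : n%:R <= (size s)%:R * n%:R :> R.
  by rewrite ler_peMl// ler1n.
have n0 : 0 <= n%:R :> R by [].
pose Jn : R := J%:R * n%:R.
have Jn0 : 0 <= Jn by rewrite mulr_ge0.
have /andP[E2 E3] : 0 <= t%:R - L%:R - Jn <= Jn * kap + 2 * n%:R.
  by rewrite /Jn; apply/andP; split; lra.
have /andP[E5 E6] : 0 <= (t%:R - L%:R - Jn) * v <= Jn * kap + 2 * n%:R.
  by apply/andP; split; [exact: mulr_ge0|nra].
have E7 : Jn * kap <= (t%:R - L%:R) * kap by rewrite ler_wpM2r ?(ltW kap0)//; lra.
have E8 : (t%:R - L%:R) * v = Jn * v + (t%:R - L%:R - Jn) * v by ring.
rewrite E8; move: H1 H2; rewrite -/Jn !ler_norml => /andP[? ?] /andP[? ?].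
by apply/andP; split; lra.
Qed.

End estimate.
End tracing.

(** * The inductive construction *)

Section construction.
Context {R : realType} {X : completeMetricType R}.
Variable e : nat -> X.
Hypothesis e_dense : forall x r, 0 < r -> exists p, mdist (e p) x < r.
Variable T : X -> X.
Hypothesis T_continuous : continuous T.
Hypothesis T_saps : strong_approx_product_structure T.
Implicit Types (mu nu : borel_prob R X).

Notation MT := (invariant_probs T : set (borel_prob R X)).
Notation kap m := (m.+1%:R^-1 : R).

Lemma mean_iter mu k j : MT mu ->
  borel_bounded (test e k \o iter j T) /\
  mean mu (test e k \o iter j T) = mean mu (test e k).
Proof.
move=> Mmu; elim: j => [|j [bj mj]]; first by split => //; exact: test_borel.
have -> : test e k \o iter j.+1 T = (test e k \o iter j T) \o T.
  by apply/funext => x /=; rewrite -iterS iterSr.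
split; first exact: borel_bounded_comp.
rewrite (mean_invariant T_continuous Mmu)// => x.
by case/andP: (test_unit e k (iter j T x)).
Qed.

(* Invariance makes mu the barycenter of the empirical measures of length n of
   its points, so no ergodic decomposition is needed. *)
Lemma exists_cycle mu n m : MT mu -> (0 < n)%N ->
  exists s : seq X, (0 < size s)%N /\ forall i, (i < m)%N ->
    `|\sum_(x <- s) birkhoff T (test e i) n x -
      (size s)%:R * n%:R * mean mu (test e i)| <= (size s)%:R * n%:R * kap m.
Proof.
move=> Mmu n0; have nR0 : 0 < n%:R :> R by rewrite ltr0n.
pose G i x := n%:R^-1 * birkhoff T (test e i) n x.
have bB i : borel_bounded (birkhoff T (test e i) n).
  rewrite /birkhoff; apply: (@borel_bounded_sum _ _ _ _
    (fun j x => test e i (iter j T x))) => j.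
  by have [] := mean_iter i j Mmu.
have bG i : borel_bounded (G i) by exact: borel_boundedZ.
have G01 i x : 0 <= G i x <= 1.
  have /andP[b0 b1] := birkhoff_unit T n x (test_unit e i).
  by rewrite /G mulr_ge0 ?invr_ge0//= mulrC ler_pdivrMr// mul1r.
have mG i : mean mu (G i) = mean mu (test e i).
  rewrite /G meanZ// /birkhoff (@mean_sum _ _ _ _ _
    (fun j x => test e i (iter j T x))); last first.
    by move=> j; have [] := mean_iter i j Mmu.
  rewrite (eq_bigr (fun=> mean mu (test e i))); last first.
    by move=> j _; have [_] := mean_iter i j Mmu.
  by rewrite sumr_const_nat subn0 -[X in _^-1 * X]mulr_natl mulKf// gt_eqF.
have [s [s0 sP]] := exists_average mu m bG G01 (invSn_gt0 m).
exists s; split => // i im; have := sP i im.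
rewrite mG -mulr_sumr -(ler_pM2l nR0) -[X in X * `|_|](ger0_norm (ltW nR0)).
by rewrite -normrM mulrBr mulVKf ?gt_eqF// !mulrA [n%:R * _]mulrC.
Qed.

Lemma exists_modulus m : exists2 d : R, 0 < d & forall x y : X, mdist x y <= d ->
  forall i, (i < m)%N -> `|test e i x - test e i y| <= kap m.
Proof.
(* The tolerance is kept fixed while the induction runs over the number of tests. *)
move: (m in kap m) => p; elim: m => [|m [d d0 dP]]; first by exists 1.
have [K K0 KP] := test_lipschitz e m.
have K10 : 0 < K + 1 by rewrite ltr_wpDl.
exists (Num.min d (kap p / (K + 1))).
  by rewrite lt_min d0 divr_gt0// invSn_gt0.
move=> x y; rewrite le_min => /andP[xd xK] i.
rewrite ltnS leq_eqVlt => /orP[/eqP->|]; last exact: dP.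
apply: le_trans (KP x y) _; rewrite ler_pdivlMr// in xK.
by apply: le_trans xK; rewrite mulrC ler_wpM2l ?mdist_ge0// lerDl.
Qed.

(** Halving makes the displacements from stage m on sum to at most 2 * eps m. *)
Lemma exists_scales (eta : R) : 0 < eta -> exists eps : nat -> R,
  [/\ forall m, 0 < eps m, eps 0%N <= eta, forall m, eps m.+1 <= eps m / 2 &
      forall m x y, mdist x y <= eps m -> forall i, (i < m)%N ->
        `|test e i x - test e i y| <= kap m].
Proof.
move=> eta0.
have /choice[d dP] m : exists d : R, 0 < d /\ forall x y : X, mdist x y <= d ->
    forall i, (i < m)%N -> `|test e i x - test e i y| <= kap m.
  by have [d ? ?] := exists_modulus m; exists d.
pose eps := fix eps m :=
  if m is p.+1 then Num.min (d m) (eps p / 2) else Num.min (d 0%N) eta.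
have eps_d m : eps m <= d m by case: m => [|m] /=; rewrite ge_min lexx.
exists eps; split.
- elim=> [|m ih] /=; rewrite lt_min; first by have [-> _] := dP 0%N.
  by have [-> _] := dP m.+1; rewrite divr_gt0.
- by rewrite /= ge_min lexx orbT.
- by move=> m /=; rewrite ge_min lexx orbT.
- move=> m x y xy; have [_] := dP m; apply; exact: le_trans xy _.
Qed.

Section scales.
Variables (eps : nat -> R) (x0 : X).
Hypothesis eps0 : forall m, 0 < eps m.
Hypothesis epsS : forall m, eps m.+1 <= eps m / 2.
Hypothesis eps_osc : forall m x y, mdist x y <= eps m ->
  forall i, (i < m)%N -> `|test e i x - test e i y| <= kap m.

Lemma eps_small (r : R) : 0 < r -> exists m, eps m < r.
Proof.
move=> r0; have small m : eps m <= eps 0%N * kap m.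
  elim: m => [|m ih]; first by rewrite invr1 mulr1.
  apply: le_trans (epsS m) _; rewrite ler_pdivrMr//.
  apply: le_trans ih _; rewrite -mulrA ler_pM2l//.
  rewrite -[leRHS]invrK lef_pV2 ?posrE ?invr_gt0 ?mulr_gt0 ?invr_gt0//.
  rewrite invfM invrK ler_pdivrMr// -natrM ler_nat; lia.
have [m mr] := invSn_lt (divr_gt0 r0 (eps0 0)).
exists m; apply: le_lt_trans (small m) _.
by rewrite mulrC -ltr_pdivlMr.
Qed.

Lemma shadow_limit (y : nat -> X) (L : nat -> nat) :
  (forall m, (0 < L m)%N) -> (forall m, (L m <= L m.+1)%N) ->
  (forall m q, (q < L m)%N -> mdist (iter q T (y m)) (iter q T (y m.+1)) < eps m) ->
  exists l, forall m q, (q < L m)%N -> mdist (iter q T (y m)) (iter q T l) <= 2 * eps m.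
Proof.
move=> L0 LS step.
have Lmono m p : (L m <= L (m + p))%N.
  by elim: p => [|p ih]; rewrite ?addn0// addnS (leq_trans ih).
(* Subtracting 2 * eps (m + p) puts the geometric sum into a form that passes through the
   induction. *)
have near m p q : (q < L m)%N ->
    mdist (iter q T (y m)) (iter q T (y (m + p)%N)) <= 2 * eps m - 2 * eps (m + p)%N.
  move=> qL; elim: p => [|p ih]; first by rewrite addn0 mdistxx subrr.
  have := step (m + p)%N q (leq_trans qL (Lmono _ _)).
  have := metric_triangle (iter q T (y m)) (iter q T (y (m + p)%N))
    (iter q T (y (m + p.+1)%N)).
  by rewrite addnS; have := epsS (m + p)%N => ? ? ?; lra.
have near2 m p q : (q < L m)%N ->
    mdist (iter q T (y m)) (iter q T (y (m + p)%N)) <= 2 * eps m.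
  by move=> /(near m p)/le_trans; apply; rewrite gerBl mulr_ge0// ltW.
have cy : cvg (y @ \oo).
  apply: cauchy_cvg; apply: cauchy_exP => r r0.
  have [m mr] := eps_small (divr_gt0 r0 (ltr0n R 2)).
  exists (y m); exists m => // p /= mp; rewrite ballEmdist/=.
  have := near2 m (p - m)%N 0%N (L0 m); rewrite subnKC//= => /le_lt_trans; apply.
  by rewrite mulrC -ltr_pdivlMr.
exists (lim (y @ \oo)) => m q qL; apply/ler_addgt0Pr => r r0.
have cq : iter q T (y p) @[p --> \oo] --> iter q T (lim (y @ \oo)).
  have cl : y p @[p --> \oo] --> lim (y @ \oo) by exact: cy.
  apply: (@cvg_comp _ _ _ y (iter q T) _ _ _ cl); exact: iter_continuous.
have [M _ MP] := cvg_ball cq r0.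
have := MP (m + M)%N (leq_addl _ _); rewrite /= ballEmdist/= metric_sym => h1.
have := near2 m M q qL.
have := metric_triangle (iter q T (y m)) (iter q T (y (m + M)%N))
  (iter q T (lim (y @ \oo))) => h2 h3; lra.
Qed.

(** A state pairs a point with the length of its orbit that later stages shadow. [NS] is the length
    demanded by the next stage, and [K] and [K'] are the additive errors of this stage and the next
    one. The new length makes the old length and both errors negligible. *)
Definition stage_post (m : nat) (NS K K' : nat) (st st' : X * nat) mu :=
  [/\ forall q, (q < st.2)%N -> mdist (iter q T st.1) (iter q T st'.1) < eps m,
      (st.2 < st'.2)%N, (NS <= st'.2)%N,
      (st.2 + K + K')%:R <= kap m * st'.2%:R &
      forall i t, (i < m)%N -> (st.2 <= t <= st'.2)%N ->
        `|birkhoff T (test e i) t st'.1 - birkhoff T (test e i) st.2 st'.1 -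
          (t%:R - st.2%:R) * mean mu (test e i)| <=
        (t%:R - st.2%:R) * (5 * kap m) + K%:R].

(** [K] depends only on the stage and its measure, not on the state. The error of the next stage is
    therefore known before the present stage has to be made long enough to absorb it. *)
Lemma exists_stage : exists (N : nat -> nat) (K : nat -> borel_prob R X -> nat),
  forall m mu st NS K', MT mu -> (N m <= st.2)%N -> (0 < st.2)%N ->
  exists st', stage_post m NS (K m mu) K' st st' mu.
Proof.
have kap01 m : 0 < kap m <= 1 by rewrite invSn_gt0/= invf_le1// ler1n.
have /choice[N NP] m := saps_trace T_saps (eps0 m) (invSn_gt0 m).
have /choice[cyc cycP] (p : nat * borel_prob R X) : exists s : seq X, MT p.2 ->
    (0 < size s)%N /\ forall i, (i < p.1)%N ->
    `|\sum_(x <- s) birkhoff T (test e i) (N p.1).+1 x -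
      (size s)%:R * (N p.1).+1%:R * mean p.2 (test e i)| <=
      (size s)%:R * (N p.1).+1%:R * kap p.1.
  have [Mp|nM] := pselect (MT p.2); last by exists [::].
  by have [s sP] := exists_cycle p.1 Mp (ltn0Sn (N p.1)); exists s.
exists N, (fun m mu => 5 * size (cyc (m, mu)) * (N m).+1)%N.
move=> m mu [y L] NS K' Mmu /= NL L0.
set s := cyc (m, mu); set n := (N m).+1.
have [s0 sP] : (0 < size s)%N /\ forall i, (i < m)%N ->
    `|\sum_(x <- s) birkhoff T (test e i) n x -
      (size s)%:R * n%:R * mean mu (test e i)| <= (size s)%:R * n%:R * kap m.
  exact: (cycP (m, mu)).
pose w j := nth x0 s (j %% size s).
(* Each piece takes at least one unit of time, so L + k bounds the new length from below; this gives
   all the length requirements. *)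
pose k := (NS + m.+1 * (L + 5 * size s * n + K')).+1%N.
have [y' [gap [y'L gapP]]] := NP m y L w n k NL L0 (leqnSn _) (ltn0Sn _).
pose L' := piece_end L n gap k.
have L'k : (L + k <= L')%N.
  rewrite /L' /piece_end leq_add2l; apply: (@leq_trans (\sum_(i < k) 1)%N).
    by rewrite sum1_card card_ord.
  by apply: leq_sum => i _; rewrite (leq_trans _ (leq_addl _ _)).
exists (y', L'); split => //=.
- by lia.
- by lia.
- rewrite mulrC ler_pdivlMr// -natrM ler_nat mulnC; lia.
- move=> i t im /andP[Lt tL'].
  have osc x z : mdist x z < eps m -> `|test e i x - test e i z| <= kap m.
    by move=> xz; apply: eps_osc (ltW xz) _ im.
  have := birkhoff_estimate (test_unit e i) (kap01 m) osc gapP s0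
    (mean_unit mu (test_lsc e i)) (fun=> erefl) (sP i im) Lt tL'.
  by rewrite !natrM.
Qed.

End scales.
End construction.

(** * Points whose empirical measures track a sequence of invariant measures *)

Section tracking.
Context {R : realType} {X : completeMetricType R}.
Variable e : nat -> X.
Hypothesis e_dense : forall x r, 0 < r -> exists p, mdist (e p) x < r.
Variable T : X -> X.
Hypothesis T_continuous : continuous T.
Hypothesis T_saps : strong_approx_product_structure T.

Notation MT := (invariant_probs T : set (borel_prob R X)).
Notation E x n := (empirical T x n : borel_prob R X).
Notation kap m := (m.+1%:R^-1 : R).
Notation S i t x := (birkhoff T (test e i) t x).

Section orbit.
Variables (eps : nat -> R) (tau : nat -> borel_prob R X) (K NS : nat -> nat).
Variables (y : nat -> X) (L : nat -> nat) (l : X).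
Hypothesis epsS : forall m, eps m.+1 <= eps m / 2.
Hypothesis eps_osc : forall m x z, mdist x z <= eps m ->
  forall i, (i < m)%N -> `|test e i x - test e i z| <= kap m.
Hypothesis stageP : forall m, stage_post e T eps m (NS m) (K m) (K m.+1)
  (y m, L m) (y m.+1, L m.+1) (tau m).
Hypothesis limP : forall m q, (q < L m)%N ->
  mdist (iter q T (y m)) (iter q T l) <= 2 * eps m.

Lemma birkhoff_limit m i t : (i < m)%N -> (t <= L m.+1)%N ->
  `|S i t (y m.+1) - S i t l| <= t%:R * kap m.
Proof.
move=> im tL; apply: birkhoff_dist => j jt; apply: (eps_osc (m := m)) im.
apply: le_trans (limP (leq_trans jt tL)) _; have := epsS m; lra.
Qed.

(** The 7 is made up of 5 from the stage estimate, 1 from passing to the limit point, and 1 for the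
    old length and the additive error. *)
Lemma birkhoff_stage_end m i : (i < m)%N ->
  `|S i (L m.+1) l - (L m.+1)%:R * mean (tau m) (test e i)| <=
  (L m.+1)%:R * (7 * kap m).
Proof.
move=> im; have [_ /= LL _ LK /(_ i (L m.+1) im)] := stageP m.
rewrite /= (ltnW LL) leqnn => /(_ isT).
have := birkhoff_limit im (leqnn _).
have /andP[v0 v1] := mean_unit (tau m) (test_lsc e i).
have /andP[b0 b1] := birkhoff_unit T (L m) (y m.+1) (test_unit e i).
have k0 : 0 <= (K m.+1)%:R :> R by [].
have Lm0 : 0 <= (L m)%:R :> R by [].
have kap0 := invSn_gt0 (R := R) m.
move: LK; rewrite /= !natrD => LK.
have Lk : 0 <= (L m)%:R * kap m by rewrite mulr_ge0// ltW.
have Lv : 0 <= (L m)%:R * mean (tau m) (test e i) <= (L m)%:R.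
  by rewrite mulr_ge0//= ler_piMr.
move: kap0 LK Lk Lv; move: (kap m) (mean (tau m) _) v0 v1 => c v v0 v1.
move=> kap0 LK Lk /andP[Lv0 Lv1].
rewrite !ler_norml => /andP[? ?] /andP[? ?]; apply/andP; split; nra.
Qed.

(** Up to time [L m.+1] the average is governed by [tau m], afterwards by [tau m.+1]. The 15 adds 7
    for the end of stage m, 5 for stage m + 1, 2 for passing to the limit point at both times, and 1
    for the additive error, already absorbed by the preceding stage. *)
Lemma birkhoff_between m i t : (i < m)%N -> (L m.+1 <= t <= L m.+2)%N ->
  `|S i t l - t%:R * mean (tau m.+1) (test e i)| <=
  t%:R * (`|mean (tau m) (test e i) - mean (tau m.+1) (test e i)| + 15 * kap m).
Proof.
move=> im /andP[Lt tL]; have im1 : (i < m.+1)%N by exact: ltnW.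
have [_ /= LL _ _ /(_ i t im1)] := stageP m.+1.
rewrite /= Lt tL => /(_ isT).
have := birkhoff_limit im1 tL; have := birkhoff_limit im1 (ltnW LL).
have := birkhoff_stage_end im.
have [_ /= _ _ LK _] := stageP m.
have Lt' : (L m.+1)%:R <= t%:R :> R by rewrite ler_nat.
have L0 : 0 <= (L m.+1)%:R :> R by [].
have k0 := invSn_gt0 (R := R) m.+1.
have kk : kap m.+1 <= kap m by exact: invSn_le.
have KL : (K m.+1)%:R <= kap m * (L m.+1)%:R.
  by apply: le_trans LK; rewrite ler_nat leq_addl.
have vv := ler_norm (mean (tau m) (test e i) - mean (tau m.+1) (test e i)).
have vv' := ler_norm (- (mean (tau m) (test e i) - mean (tau m.+1) (test e i))).
rewrite normrN in vv'.
move: k0 kk KL vv vv'; move: (kap m) (kap m.+1) => c c'.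
move: (mean (tau m) _) (mean (tau m.+1) _) => v0 v.
move: (`|v0 - v|) => d k0 kk KL vv vv'.
set Lr : R := (L m.+1)%:R in Lt' L0 KL *; set tr : R := t%:R in Lt' *.
move: (S i (L m.+1) l) (S i (L m.+1) (y m.+2)) (S i t (y m.+2)) (S i t l).
move: (K m.+1)%:R KL => Kr KL a b a' b'.
rewrite !ler_norml => /andP[A1 A2] /andP[B1 B2] /andP[C1 C2] /andP[D1 D2].
have d0 : 0 <= d by lra.
have h1 : Lr * c <= tr * c by rewrite ler_wpM2r//; lra.
have h2 : Lr * c' <= tr * c by rewrite (le_trans _ h1)// ler_wpM2l.
have h3 : tr * c' <= tr * c by rewrite ler_wpM2l//; lra.
have h4 : 0 <= Lr * c' by rewrite mulr_ge0// ltW.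
have h5 : Lr * d <= tr * d by rewrite ler_wpM2r.
have h6 : Lr * (v0 - v) <= Lr * d by rewrite ler_wpM2l.
have h7 : Lr * - (v0 - v) <= Lr * d by rewrite ler_wpM2l.
by apply/andP; split; lra.
Qed.

End orbit.

Lemma mean_empirical_birkhoff x n k :
  mean (E x n) (test e k) = n.+1%:R^-1 * S k n.+1 x.
Proof. by rewrite mean_empirical_test /birkhoff big_mkord. Qed.

(** The four conclusions serve, in order, density, continuity of the reductions, producing limit
    measures, and excluding other limit measures. *)
Lemma exists_tracking (eta : R) (x0 : X) : 0 < eta ->
  exists F : (nat -> borel_prob R X) -> X,
  [/\ forall tau, (forall m, MT (tau m)) -> mdist x0 (F tau) < eta,
      forall r, 0 < r -> exists n, forall tau tau', (forall m, MT (tau m)) ->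
        (forall m, MT (tau' m)) -> (forall i, (i < n)%N -> tau i = tau' i) ->
        mdist (F tau) (F tau') < r,
      forall tau, (forall m, MT (tau m)) -> forall k, exists M, forall m,
        (M <= m)%N -> exists2 t, (m <= t)%N & test_close e k (E (F tau) t) (tau m) &
      forall tau, (forall m, MT (tau m)) -> forall k, exists M, forall t,
        (M <= t)%N -> exists2 m, (k <= m)%N & forall i, (i < k)%N ->
        `|mean (E (F tau) t) (test e i) - mean (tau m.+1) (test e i)| <
        `|mean (tau m) (test e i) - mean (tau m.+1) (test e i)| + kap k].
Proof.
move=> eta0.
(* The limit point may move by 2 * eps 0, which is less than eta once eps 0 <= eta / 3. *)
have [eps [eps0 eps_eta epsS eps_osc]] :=
  exists_scales e (divr_gt0 eta0 (ltr0n R 3)).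
have [N [K NKP]] := exists_stage T_continuous T_saps x0 eps0 eps_osc.
(* One choice function is fixed for all sequences, so sequences that agree up to index m have the
   same state at stage m; this is the source of continuity. *)
have /choice[f fP] (p : nat * (X * nat) * (borel_prob R X * borel_prob R X)) :
    exists st', MT p.2.1 -> (N p.1.1 <= p.1.2.2)%N -> (0 < p.1.2.2)%N ->
    stage_post e T eps p.1.1 (N p.1.1.+1) (K p.1.1 p.2.1) (K p.1.1.+1 p.2.2)
      p.1.2 st' p.2.1.
  have [[H1 [H2 H3]]|nH] := pselect (MT p.2.1 /\ (N p.1.1 <= p.1.2.2)%N /\
      (0 < p.1.2.2)%N); last by exists p.1.2 => ? ? ?; case: nH.
  by have [st' st'P] := NKP p.1.1 p.2.1 p.1.2 (N p.1.1.+1) (K p.1.1.+1 p.2.2) H1 H2 H3;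
    exists st'.
pose st tau := fix st m : X * nat :=
  if m is p.+1 then f (p, st p, (tau p, tau p.+1)) else (x0, (N 0%N).+1).
have stP tau : (forall m, MT (tau m)) -> forall m, [/\ (N m <= (st tau m).2)%N,
    (0 < (st tau m).2)%N & stage_post e T eps m (N m.+1) (K m (tau m))
      (K m.+1 (tau m.+1)) (st tau m) (st tau m.+1) (tau m)].
  move=> Mtau; elim=> [|m [h1 h2 h3]].
    have N0 : (N 0%N <= (st tau 0%N).2)%N by exact: leqnSn.
    by split=> //; exact: (fP (0%N, st tau 0%N, (tau 0%N, tau 1%N)) (Mtau 0%N) N0).
  have h1' : (N m.+1 <= (st tau m.+1).2)%N by case: h3.
  have h2' : (0 < (st tau m.+1).2)%N.
    by case: h3 => _ h3 _ _ _; exact: leq_ltn_trans h3.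
  by split=> //; exact: (fP (m.+1, st tau m.+1, (tau m.+1, tau m.+2)) (Mtau m.+1) h1' h2').
have /choice[F FP] tau : exists l, (forall m, MT (tau m)) -> forall m q,
    (q < (st tau m).2)%N ->
    mdist (iter q T (st tau m).1) (iter q T l) <= 2 * eps m.
  have [Mtau|nM] := pselect (forall m, MT (tau m)); last by exists x0.
  have [|||l lP] := @shadow_limit R X T T_continuous eps eps0 epsS
    (fun m => (st tau m).1) (fun m => (st tau m).2).
  - by move=> m; case: (stP tau Mtau m).
  - by move=> m; have [_ _ [_ /ltnW]] := stP tau Mtau m.
  - by move=> m; have [_ _ []] := stP tau Mtau m.
  by exists l.
have st_ge tau : (forall m, MT (tau m)) -> forall m, (m < (st tau m).2)%N.
  move=> Mtau; elim=> [|m ih]; first by case: (stP tau Mtau 0%N).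
  by have [_ _ [_ + _ _ _]] := stP tau Mtau m; exact: leq_ltn_trans.
have kapM k : 0 < (15 * k.+1)%:R :> R by rewrite ltr0n.
have kap_small m k : (16 * k.+1 <= m)%N -> 15 * kap m < kap k.
  move=> km; rewrite -ltr_pdivlMl// -invfM -natrM ltf_pV2 ?posrE// ltr_nat; lia.
exists F; split.
- move=> tau Mtau.
  have := FP tau Mtau 0%N 0%N; rewrite /= => /(_ isT) h.
  by apply: le_lt_trans h _; lra.
- move=> r r0; have [m mr] := eps_small eps0 epsS (divr_gt0 r0 (ltr0n R 4)).
  exists m.+1 => tau tau' Mtau Mtau' agree.
  have stE p : (p <= m)%N -> st tau p = st tau' p.
    elim: p => //= p ih pm; rewrite ih ?(ltnW pm)// !agree//.
    by rewrite ltnS ltnW.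
  have h1 := FP tau Mtau m 0%N (leq_ltn_trans (leq0n _) (st_ge tau Mtau m)).
  have h2 := FP tau' Mtau' m 0%N (leq_ltn_trans (leq0n _) (st_ge tau' Mtau' m)).
  rewrite /= stE//= metric_sym in h1; rewrite /= in h2.
  by have := metric_triangle (F tau) (st tau' m).1 (F tau') => ?; lra.
- move=> tau Mtau k; exists (16 * k.+1)%N => m km.
  have Lm := st_ge tau Mtau m.+1.
  (* [empirical T x n] averages n + 1 points, hence the predecessor. *)
  exists (st tau m.+1).2.-1; first by lia.
  move=> i ik; rewrite mean_empirical_birkhoff prednK; last by lia.
  have im : (i < m)%N by lia.
  have L0 : 0 < (st tau m.+1).2%:R :> R by rewrite ltr0n; lia.
  have := @birkhoff_stage_end eps tau (fun m => K m (tau m)) (fun m => N m.+1)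
    (fun m => (st tau m).1) (fun m => (st tau m).2) (F tau) epsS eps_osc _
    (FP tau Mtau) m i im.
  have stageP p : stage_post e T eps p (N p.+1) (K p (tau p)) (K p.+1 (tau p.+1))
      ((st tau p).1, (st tau p).2) ((st tau p.+1).1, (st tau p.+1).2) (tau p).
    by rewrite -!surjective_pairing; case: (stP tau Mtau p).
  move=> /(_ stageP) H; rewrite -(ltr_pM2l L0).
  rewrite -[X in X * `|_|](ger0_norm (ltW L0)) -normrM mulrBr mulVKf ?gt_eqF//.
  apply: le_lt_trans H _; rewrite ltr_pM2l//.
  have := kap_small m k km; have := invSn_gt0 (R := R) m.
  by move: (kap m) (kap k) => c d; lra.
- move=> tau Mtau k; pose m0 := (16 * k.+1)%N.
  exists (st tau m0.+1).2 => t Mt.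
  have [m [m0m Lm tL]] : exists m, [/\ (m0 <= m)%N,
      ((st tau m.+1).2 <= t.+1)%N & (t.+1 <= (st tau m.+2).2)%N].
    suff : forall p, (t.+1 <= (st tau (m0.+1 + p)%N).2)%N -> exists m,
        [/\ (m0 <= m)%N, ((st tau m.+1).2 <= t.+1)%N & (t.+1 <= (st tau m.+2).2)%N].
      apply; apply: leq_trans (ltnW (st_ge tau Mtau (m0.+1 + t.+1)%N)).
      by rewrite leq_addl.
    elim=> [|p ih] tp; first by move: tp; rewrite addn0; lia.
    have [/ih//|lt] := leqP t.+1 (st tau (m0.+1 + p)%N).2.
    exists (m0 + p)%N; split; first by lia.
      by rewrite -addSn ltnW.
    by move: tp; rewrite addnS addSn.
  exists m; first by rewrite /m0 in m0m; lia.
  move=> i ik; rewrite mean_empirical_birkhoff.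
  have im : (i < m)%N by rewrite /m0 in m0m; lia.
  have t0 : 0 < t.+1%:R :> R by rewrite ltr0n.
  have := @birkhoff_between eps tau (fun m => K m (tau m)) (fun m => N m.+1)
    (fun m => (st tau m).1) (fun m => (st tau m).2) (F tau) epsS eps_osc _
    (FP tau Mtau) m i t.+1 im.
  have stageP p : stage_post e T eps p (N p.+1) (K p (tau p)) (K p.+1 (tau p.+1))
      ((st tau p).1, (st tau p).2) ((st tau p.+1).1, (st tau p.+1).2) (tau p).
    by rewrite -!surjective_pairing; case: (stP tau Mtau p).
  move=> /(_ stageP); rewrite Lm tL => /(_ isT) H; rewrite -(ltr_pM2l t0).
  rewrite -[X in X * `|_ * _ - _|](ger0_norm (ltW t0)) -normrM mulrBr mulVKf ?gt_eqF//.
  apply: le_lt_trans H _; rewrite ltr_pM2l// ltrD2l.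
  exact: kap_small.
Qed.

End tracking.

(** * Proof of the theorem *)

Lemma separable_sequence (R : realType) (X : completeMetricType R) :
  separable X -> exists e : nat -> X,
  forall x r, 0 < r -> exists p, mdist (e p) x < r.
Proof.
move=> [D [cD dD]].
have [D0|[g]] : D = set0 \/ $|{surjfun [set: nat] >-> D}| by exact/pfcard_geP.
  by have [//|x []] := dD setT _ openT; [exists point|rewrite D0].
exists g => x r r0.
have [|y [xy Dy]] := dD (ball x r)° _ (open_interior _).
  by exists x; exact: nbhsx_ballx.
have [p _ py] : (g @` setT) y by exact: (@surj _ _ _ _ g).
exists p; rewrite py metric_sym.
by move/interior_subset : xy; rewrite ballEmdist.
Qed.

Section theorem.
Context {R : realType} {X : completeMetricType R}.
Variable e : nat -> X.
Hypothesis e_dense : forall x r, 0 < r -> exists p, mdist (e p) x < r.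
Variable T : X -> X.
Hypothesis T_continuous : continuous T.
Hypothesis T_saps : strong_approx_product_structure T.
Implicit Types (V : set (borel_prob R X)) (z : nat -> nat).

Notation MT := (invariant_probs T : set (borel_prob R X)).
Notation E x n := (empirical T x n : borel_prob R X).
Notation close := (test_close e).

Definition prefix_continuous (f : (nat -> nat) -> X) :=
  forall r : R, (0 < r)%R -> exists n, forall z w,
    (forall i, (i < n)%N -> w i = z i) -> ball (f z) r (f w).

Lemma closed_singleton (mu : borel_prob R X) : closed [set mu].
Proof.
move=> nu cl; apply/esym; apply: (test_close_separating e_dense) => k.
by have [_ [-> ]] := cl _ (test_close_nbhs e k nu); exact: test_close_sym.
Qed.

(** Failure of divergence means values below some q infinitely often along [M]; the pigeonhole
    principle is carried out by induction on q. *)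
Lemma infinitely_often_value (M : set nat) z : ~ diverges_along M z ->
  exists q, forall N, exists m, [/\ (N <= m)%N, M m & z m = q].
Proof.
move=> /existsNP[q /forallNP H].
have {}H N : exists m, [/\ (N <= m)%N, M m & (z m < q)%N].
  have /existsNP[m /not_implyP[Nm /not_implyP[Mm /negP]]] := H N.
  by rewrite -ltnNge => ?; exists m.
elim: q H => [|q ih] H; first by have [m []] := H 0%N.
have [[N0 HN0]|/forallNP HN] := pselect (exists N0, forall m, (N0 <= m)%N -> M m ->
    z m <> q).
  apply: ih => N; have [m [Nm Mm]] := H (maxn N N0).
  rewrite ltnS leq_eqVlt => /orP[/eqP zq|zq].
    by exfalso; apply: (HN0 m) => //; lia.
  by exists m; split => //; lia.
exists q => N; have /existsNP[m /not_implyP[Nm /not_implyP[Mm /contrapT]]] := HN N.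
by exists m.
Qed.

Lemma exists_reduction V (x0 : X) (eta : R) : V `<=` MT -> V !=set0 ->
  closed (V : set (subspace MT)) -> connected V -> MT `\` V !=set0 -> 0 < eta ->
  exists (M : set nat) (f : (nat -> nat) -> X),
  [/\ forall N, exists2 m, (N <= m)%N & M m, prefix_continuous f,
      forall z, mdist x0 (f z) < eta,
      forall z, diverges_along M z -> G_exact T V (f z) /\
        forall mu, V = [set mu] -> generic T mu (f z) &
      forall z, ~ diverges_along M z -> (limit_measures T (f z) `&` (MT `\` V)) !=set0].
Proof.
move=> VM V0 clV cV U0 eta0.
have [alpha0 [beta [Va0 Ub beta_close]]] :=
  exists_boundary_sequence e_dense T_continuous VM clV V0 U0.
have [d [Vd dP]] := exists_dense_sequence e V0.
have [c cP] := exists_infinitely_often_enum.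
(* Every [d j], and also the boundary point [alpha0], occurs infinitely often. *)
pose d' n := if c n is j.+1 then d j else alpha0.
have Vd' n : V (d' n) by rewrite /d'; case: (c n).
have [alpha [Valpha astep avisit]] := exists_schedule e cV Vd'.
have visit j N : exists2 m, (N <= m)%N & alpha m = if j is i.+1 then d i else alpha0.
  have [n Nn cn] := cP j N; have [m nm am] := avisit n.
  by exists m; [exact: leq_trans nm|rewrite am /d' cn].
have [F [Fnear Fcont Fend Ftrack]] := exists_tracking e T_continuous T_saps x0 eta0.
pose M : set nat := [set m | alpha m = alpha0].
pose tau z m := if pselect (M m) then beta (z m) else alpha m.
have Mtau z m : MT (tau z m).
  by rewrite /tau; case: pselect => ?; [case: (Ub (z m))|exact: VM].
exists M, (fun z => F (tau z)); split.
- by move=> N; have [m Nm am] := visit 0%N N; exists m.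
- move=> r r0; have [n nP] := Fcont r r0; exists n => z w zw.
  by rewrite ballEmdist/=; apply: nP => // i /zw; rewrite /tau => ->.
- by move=> z; exact: Fnear.
- move=> z zM; have tau_alpha k : exists N, forall m, (N <= m)%N ->
      close k (tau z m) (alpha m).
    have [N NP] := zM k; exists N => m Nm; rewrite /tau.
    case: pselect => [Mm|?]; last exact: test_close_refl.
    by rewrite Mm; apply: beta_close; exact: NP.
  have tau_step k : exists N, forall m, (N <= m)%N -> close k (tau z m) (tau z m.+1).
    have [N1 NP1] := tau_alpha k.*2.+1.*2.+1.
    have [N2 _ NP2] := astep k.*2.+1.*2.+1.
    exists (maxn N1 N2) => m; rewrite geq_max => /andP[N1m N2m].
    apply: (@test_close_trans _ _ e _ _ (alpha m.+1)).
      by apply: test_close_trans (NP1 m N1m) (NP2 m N2m).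
    apply: test_close_sym; apply: test_close_le (NP1 m.+1 (leqW N1m)); lia.
  (* Consecutive terms of [tau z] become close, so at every late time, also inside a stage, the
     empirical measure is near a member of [V]. *)
  have track k : exists N, forall t, (N <= t)%N ->
      exists m, close k (E (F (tau z)) t) (alpha m).
    have [N1 NP1] := tau_alpha k.*2.+1.
    have [N2 NP2] := tau_step k.*2.+1.*2.+1.
    pose K := maxn k.*2.+1.*2.+1 (maxn N1 N2).
    have [N NP] := Ftrack (tau z) (Mtau z) K.
    exists N => t Nt; have [m Km mP] := NP t Nt; exists m.+1.
    have [K1 K2 K3] : [/\ (k.*2.+1.*2.+1 <= K)%N, (N1 <= m.+1)%N & (N2 <= m)%N].
      move: Km; rewrite /K !geq_max => /and3P[? ? ?].
      by rewrite leq_max leqnn; split => //; lia.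
    apply: test_close_trans (NP1 _ K2) => i ik.
    have iK : (i < k.*2.+1.*2.+1)%N by lia.
    apply: lt_le_trans (mP i (leq_trans iK K1)) _.
    apply: le_trans (lerD (ltW (NP2 m K3 i iK)) (invSn_le K1)) _.
    rewrite (_ : k.*2.+1.*2.+2 = (k.*2.+2 * 2)%N); last by lia.
    by rewrite natrM invfM -splitr.
  split; last first.
    move=> mu Vmu; apply/(test_close_cvgP e_dense) => k.
    have [N NP] := track k; exists N => // t /= Nt; have [m] := NP t Nt.
    by have := Valpha m; rewrite Vmu => ->.
  split=> nu.
    move=> Vnu; apply/(limit_measuresP e_dense) => k N.
    pose K := k.*2.+1.*2.+1.
    have [j jP] := dP nu k.*2.+1 Vnu.
    have [N1 NP1] := tau_alpha K.
    have [N2 NP2] := Fend (tau z) (Mtau z) K.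
    have [m Nm am] := visit j.+1 (maxn N (maxn N1 N2)).
    move: Nm; rewrite !geq_max => /and3P[Nm N1m N2m].
    have [t mt tP] := NP2 m N2m; exists t; first exact: leq_trans mt.
    apply: test_close_trans jP; rewrite -am.
    exact: test_close_trans tP (NP1 m N1m).
  move=> nuV; have Mnu := limit_measures_invariant e_dense T_continuous nuV.
  have /choice[u uP] k : exists rho, V rho /\ close k rho nu.
    have [N NP] := track k.*2.+1.
    have [t Nt tP] := proj1 (limit_measuresP e_dense T _ _) nuV k.*2.+1 N.
    have [m mP] := NP t Nt; exists (alpha m); split => //.
    exact: test_close_trans (test_close_sym mP) tP.
  apply: (closed_subspace_limit e_dense (u := u)) VM clV _ Mnu _.
    by move=> n; case: (uP n).
  by move=> k; exists k => // n /= kn; apply: test_close_le kn _; case: (uP n).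
- move=> z /infinitely_often_value[q qP]; exists (beta q); split => //.
  apply/(limit_measuresP e_dense) => k N.
  have [N0 NP] := Fend (tau z) (Mtau z) k.
  have [m [Nm Mm zm]] := qP (maxn N N0).
  move: Nm; rewrite geq_max => /andP[Nm N0m].
  have [t mt] := NP m N0m; exists t; first exact: leq_trans mt.
  by rewrite -zm (_ : beta (z m) = tau z m)// /tau; case: pselect.
Qed.

(** A value j + 1 makes the orbit follow [d j], and the value 0 makes it follow a measure outside
    [V]. An eventually zero sequence leaves that measure as the only possible limit measure. *)
Lemma G_upper_not_Sigma02 V : V `<=` MT -> V !=set0 -> MT `\` V !=set0 ->
  ~ Sigma0 2 (G_upper T V).
Proof.
move=> VM V0 [nu [Mnu nVnu]]; have [d [Vd dP]] := exists_dense_sequence e V0.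
have [F [_ Fcont Fend Ftrack]] :=
  exists_tracking e T_continuous T_saps point (@ltr01 R).
pose tau z m := if z m is j.+1 then d j else nu.
have Mtau z m : MT (tau z m) by rewrite /tau; case: (z m) => // j; exact: VM.
apply: (not_Sigma02_preimage (f := fun z => F (tau z))).
- move=> r r0; have [n nP] := Fcont r r0; exists n => z w zw.
  by rewrite ballEmdist/=; apply: nP => // i /zw; rewrite /tau => ->.
- move=> z zinf mu Vmu; apply/(limit_measuresP e_dense) => k N.
  have [j jP] := dP mu k.*2.+1 Vmu.
  have [N0 NP] := Fend (tau z) (Mtau z) k.*2.+1.
  have [m Nm zm] := zinf j (maxn N N0).
  move: Nm; rewrite geq_max => /andP[Nm N0m].
  have [t mt tP] := NP m N0m; exists t; first exact: leq_trans mt.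
  by apply: test_close_trans jP; rewrite /tau zm in tP.
- move=> z N0 z0 GV; have [mu Vmu] := V0; apply: nVnu.
  suff <- : mu = nu by [].
  apply: (test_close_separating e_dense) => k.
  have [N NP] := Ftrack (tau z) (Mtau z) (maxn N0 k.*2.+1).
  have [t Nt tP] := proj1 (limit_measuresP e_dense T _ _) (GV mu Vmu) k.*2.+1 N.
  have [m Km mP] := NP t Nt.
  apply: (test_close_trans (test_close_sym tP)) => i ik.
  have tauE p : (N0 <= p)%N -> tau z p = nu by move=> /z0 zp; rewrite /tau zp.
  move: Km; rewrite geq_max => /andP[N0m Km].
  have := mP i; rewrite !tauE ?(leqW N0m)// subrr normr0 add0r leq_max ik orbT.
  move=> /(_ isT)/lt_le_trans; apply; apply: invSn_le; exact: leq_maxr.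
Qed.

Lemma dense_of_near (A : set X) :
  (forall x (r : R), 0 < r -> exists2 y, A y & mdist x y < r) -> dense A.
Proof.
move=> H O [x Ox] oO; have /nbhs_ballP[r /= r0 rO] : nbhs x O.
  exact: open_nbhs_nbhs.
have [y Ay xy] := H x r r0; exists y; split => //; apply: rO.
by rewrite ballEmdist.
Qed.

(** The reduction is used with V = {mu}. Without compactness, having mu as the only limit measure
    does not give convergence, so [exists_reduction] supplies genericity separately. *)
Lemma generic_Pi03_complete (mu nu : borel_prob R X) : MT mu -> MT nu ->
  nu <> mu -> Pi0_complete 3 (generic T mu).
Proof.
move=> Mmu Mnu numu; split; first exact: (generic_Pi03 e_dense).
have VM : [set mu] `<=` MT by move=> _ ->.
have clV : closed ([set mu] : set (subspace MT)).
  by apply/closed_subspaceP; exists [set mu] => //; exact: closed_singleton.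
have [||||M [f [Minf fcont _ fin fout]]] := @exists_reduction [set mu] point 1 VM _ clV.
- by exists mu.
- exact: connected1.
- by exists nu.
- exact: ltr01.
apply: (not_Sigma03_preimage fcont Minf); apply/seteqP; split=> z.
  move=> gz; apply: contrapT => /fout[rho [rhoV [_ nV]]]; apply: nV.
  apply: (test_close_separating e_dense) => k.
  have [N _ NP] := proj1 (test_close_cvgP e_dense _ _) gz k.*2.+1.
  have [t Nt tP] := proj1 (limit_measuresP e_dense T _ _) rhoV k.*2.+1 N.
  exact: test_close_trans (test_close_sym tP) (NP t Nt).
by move=> /fin[_]; exact.
Qed.

Section measure_set.
Variable V : set (borel_prob R X).
Hypotheses (VM : V `<=` MT) (V0 : V !=set0).
Hypotheses (clV : closed (V : set (subspace MT))) (cV : connected V).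
Hypothesis U0 : MT `\` V !=set0.

Lemma G_lowerC x : (limit_measures T x `&` (MT `\` V)) !=set0 ->
  ~ G_lower T V x.
Proof. by move=> [nu [nuV [_ nVnu]]] /(_ _ nuV). Qed.

(** Stated for any set between G(V) and G_V, so that one reduction treats these two sets and the
    complement of the set of points with a limit measure in U. *)
Lemma G_not_Sigma03 A : G_exact T V `<=` A -> A `<=` G_lower T V ->
  ~ Sigma0 3 A.
Proof.
move=> GA AG.
have [M [f [Minf fcont _ fin fout]]] := exists_reduction point VM V0 clV cV U0 ltr01.
apply: (not_Sigma03_preimage fcont Minf); apply/seteqP; split=> z.
  by move=> /AG Gz; apply: contrapT => /fout/G_lowerC.
by move=> /fin[+ _]; exact: GA.
Qed.

Lemma G_exact_dense : dense (G_exact T V).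
Proof.
apply: dense_of_near => x r r0.
have [M [f [_ _ fnear fin _]]] := exists_reduction x VM V0 clV cV U0 r0.
(* The identity sequence diverges along any set. *)
exists (f id) => //; apply: proj1 (fin id _).
by move=> q; exists q.
Qed.

Lemma G_meet_dense : dense (G_meet T (MT `\` V)).
Proof.
apply: dense_of_near => x r r0.
have [M [f [Minf _ fnear _ fout]]] := exists_reduction x VM V0 clV cV U0 r0.
exists (f (fun=> 0%N)) => //; apply: fout => /(_ 1%N)[N NP].
by have [m Nm Mm] := Minf N; have := NP m Nm Mm.
Qed.

End measure_set.
End theorem.

Lemma denseS (X : topologicalType) (A B : set X) : A `<=` B -> dense A -> dense B.
Proof. by move=> AB dA O O0 oO; have [x [Ox /AB Bx]] := dA O O0 oO; exists x. Qed.

Theorem theorem29 (R : realType) (X : completeMetricType R) (T : X -> X)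
    (X_separable : separable X) (T_continuous : continuous T)
    (T_saps : strong_approx_product_structure T) :
  let MT : set (borel_prob R X) := invariant_probs T in
  ((exists mu nu, [/\ MT mu, MT nu & mu <> nu]) ->
     forall mu, MT mu -> Pi0_complete 3 (generic T mu)) /\
  (forall V : set (borel_prob R X),
     V `<=` MT -> V !=set0 -> closed (V : set (subspace MT)) -> connected V ->
     let U := MT `\` V in
     U !=set0 ->
     [/\ Pi0_hard 3 (G_lower T V) /\ Pi0_hard 3 (G_exact T V),
         Sigma0_hard 3 (G_meet T U),
         Pi0_complete 2 (G_upper T V) &
         [/\ dense (G_lower T V), dense (G_upper T V),
             dense (G_exact T V) & dense (G_meet T U)]]).
Proof.
move=> MT; have [e e_dense] := separable_sequence X_separable; split.
  move=> [mu1 [mu2 [M1 M2 ne]]] mu Mmu.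
  have [mu1E|mu1N] := pselect (mu1 = mu).
    by apply: (generic_Pi03_complete e_dense T_continuous T_saps Mmu M2); congruence.
  exact: (generic_Pi03_complete e_dense T_continuous T_saps Mmu M1).
move=> V VM V0 clV cV U U0.
have hard := G_not_Sigma03 e_dense T_continuous T_saps VM V0 clV cV U0.
have dG := G_exact_dense e_dense T_continuous T_saps VM V0 clV cV U0.
split.
- by split; apply: hard => // x [].
(* All limit measures are invariant, so one that is not in U belongs to V. *)
- apply: hard => x; first by move=> [_ Gx] mx; exact: G_lowerC mx Gx.
  move=> nm nu nuV; apply: contrapT => nV; apply: nm; exists nu; split => //.
  by split => //; exact: (limit_measures_invariant e_dense T_continuous nuV).
- split; first exact: (G_upper_Pi02 e_dense).
  exact: (G_upper_not_Sigma02 e_dense T_continuous T_saps VM V0 U0).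
- split => //.
  + by apply: denseS dG => x [].
  + by apply: denseS dG => x [].
  + exact: (G_meet_dense e_dense T_continuous T_saps VM V0 clV cV U0).
Qed.
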